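(* Let $N\ge0$, $\mathbf a_N=(a(0),\dots,a(N))\in\mathbb C^{N+1}$, $\varepsilon_2>0$, let $g_1$ be a given bounded spectral density, and $$D_{1\varepsilon_2}=\left\{g:\frac1{2\pi}\int_{-\pi}^\pi|g(\lambda)-g_1(\lambda)|d\lambda\le\varepsilon_2\right\}.$$ Let the spectral density $f(\lambda)$ be known, let $g_0\in D_{1\varepsilon_2}$, let $\int_{-\pi}^\pi(f+g_0)^{-1}d\lambda<\infty$, put $C_N^0(e^{i\lambda})=\sum_{j=0}^N((\mathbf B_N^0)^{-1}\mathbf R_N^0\mathbf a_N)_je^{ij\lambda}$, and let $$h_g(f,g_0)=\frac{|A_N(e^{i\lambda})f(\lambda)-C_N^0(e^{i\lambda})|^2}{(f(\lambda)+g_0(\lambda))^2}$$ be bounded. Suppose that for some constant $\alpha_2>0$ $$g_0(\lambda)=\max\left\{g_1(\lambda),\ \alpha_2^{-1}\left|A_N(e^{i\lambda})f(\lambda)-C_N^0(e^{i\lambda})\right|-f(\lambda)\right\}$$ and that $(f,g_0)$ determines a solution to the optimization problem $$\max_{g\in D_{1\varepsilon_2}}\left(\langle\mathbf R_N\mathbf a_N,\mathbf B_N^{-1}\mathbf R_N\mathbf a_N\rangle+\langle\mathbf Q_N\mathbf a_N,\mathbf a_N\rangle\right)=\langle\mathbf R_N^0\mathbf a_N,(\mathbf B_N^0)^{-1}\mathbf R_N^0\mathbf a_N\rangle+\langle\mathbf Q_N^0\mathbf a_N,\mathbf a_N\rangle .$$ Then $g_0$ is the least favourable spectral density in $D_{1\varepsilon_2}$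 for the optimal linear estimate of $A_N\xi=\sum_{j=0}^Na(j)\xi(j)$ from observations of $\xi(j)+\eta(j)$, $j\in\mathbb Z\setminus\{0,\dots,N\}$, and $$h^0(e^{i\lambda})=\frac{A_N(e^{i\lambda})f(\lambda)-C_N^0(e^{i\lambda})}{f(\lambda)+g_0(\lambda)}$$ is the minimax-robust spectral characteristic of the optimal linear estimate of $A_N\xi$.
   Context: $\xi,\eta$ are zero mean uncorrelated wide sense stationary sequences with spectral densities $f,g$ ($E\xi(j+k)\overline{\xi(j)}=\frac1{2\pi}\int e^{ik\lambda}f\,d\lambda$, etc.). $A_N(e^{i\lambda})=\sum_{j=0}^Na(j)e^{ij\lambda}$, $\langle x,y\rangle=\sum_{k=0}^Nx_k\overline{y_k}$. $\mathbf B_N,\mathbf R_N,\mathbf Q_N$ are the $(N+1)\times(N+1)$ matrices with entries $\frac1{2\pi}\int_{-\pi}^\pi e^{-i(j-k)\lambda}\psi(\lambda)d\lambda$, $j,k=0,\dots,N$, with $\psi=\frac1{f+g}$, $\frac f{f+g}$, $\frac{fg}{f+g}$ respectively; superscript $0$ refers to $(f,g_0)$. Wherever $\mathbf B_N^{-1}$ is used, $(f,g)$ is understood to satisfy $\int(f+g)^{-1}d\lambda<\infty$. $L_2^N(f+g)$ is the closed span of $\{e^{ij\lambda}:j\in\mathbb Z\setminus\{0,\dots,N\}\}$ in $L_2(f+g)$; for $h\in L_2^N(f+g)$, $\Delta(h;f,g)=\frac1{2\pi}\int|A_N-h|^2f\,d\lambda+\frac1{2\pi}\int|h|^2g\,d\lambda$,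 and $h(f,g)$ is its minimizer. With $f$ fixed, $g_0$ is least favourable in a class $D_g$ if $\Delta(h(f,g_0);f,g_0)=\max_{g\in D_g}\Delta(h(f,g);f,g)$; $h^0$ is minimax-robust if $h^0\in H_D=\bigcap_{g\in D_g}L_2^N(f+g)$ and $\min_{h\in H_D}\max_{g\in D_g}\Delta(h;f,g)=\sup_{g\in D_g}\Delta(h^0;f,g)$. *)

(* Defs.v *)
(* MathComp-Analysis *)
From HB Require Import structures.
From mathcomp Require Import all_boot all_order all_algebra.
From mathcomp Require Import all_classical all_reals all_analysis.
From mathcomp Require Import complex.

Set Implicit Arguments.
Unset Strict Implicit.
Unset Printing Implicit Defensive.

Import Order.TTheory GRing.Theory Num.Theory.
Import numFieldNormedType.Exports.

Local Open Scope classical_set_scope.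
Local Open Scope ring_scope.
Local Open Scope complex_scope.

Section Interpolation.
Context {R : realType}.
Implicit Types (f g w : R -> R) (h p : R -> R[i]) (D : set (R -> R)).

Local Notation mu := (@lebesgue_measure R).

Definition circle : set R := `[- pi, pi].

Definition cmodulus (z : R[i]) : R := ComplexField.Normc.normc z.

Definition expi (t : R) : R[i] := cos t +i* sin t.

Definition cmeasurable h : Prop :=
  measurable_fun circle (fun x => complex.Re (h x)) /\
  measurable_fun circle (fun x => complex.Im (h x)).

Definition cintegral h : R[i] :=
  (\int[mu]_(x in circle) complex.Re (h x))%R +i*
  (\int[mu]_(x in circle) complex.Im (h x))%R.

Definition ess_bounded (u : R -> R) : Prop :=
  exists M : R, {ae mu, forall x, circle x -> `|u x| <= M}.

Definition spectral_density f : Prop :=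
  (forall x, circle x -> 0 <= f x) /\
  mu.-integrable circle (fun x => (f x)%:E).

(* The inverse is the one of \bar R, for which 0^-1 = +oo: the condition fails
   when f + g vanishes on a set of positive measure. *)
Definition minimality f g : Prop :=
  (\int[mu]_(x in circle) ((f x + g x)%:E)^-1 < +oo)%E.

Definition trigpoly (N : nat) (c : 'cV[R[i]]_N.+1) (x : R) : R[i] :=
  \sum_(j < N.+1) c j 0 * expi (j%:R * x).

Definition toeplitz (N : nat) (psi : R -> R) : 'M[R[i]]_N.+1 :=
  \matrix_(j, k) (((2 * pi)^-1)%:C *
    cintegral (fun x => expi (- ((j%:R - k%:R) * x)) * (psi x)%:C)).

Definition matB (N : nat) f g : 'M[R[i]]_N.+1 :=
  toeplitz N (fun x => 1 / (f x + g x)).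
Definition matR (N : nat) f g : 'M[R[i]]_N.+1 :=
  toeplitz N (fun x => f x / (f x + g x)).
Definition matQ (N : nat) f g : 'M[R[i]]_N.+1 :=
  toeplitz N (fun x => f x * g x / (f x + g x)).

Definition cdot (N : nat) (x y : 'cV[R[i]]_N.+1) : R[i] :=
  \sum_k x k 0 * (y k 0)^*.

Definition interp_coef (N : nat) (a : 'cV[R[i]]_N.+1) f g : 'cV[R[i]]_N.+1 :=
  invmx (matB N f g) *m (matR N f g *m a).

(* C_N. *)
Definition interp_poly (N : nat) (a : 'cV[R[i]]_N.+1) f g : R -> R[i] :=
  trigpoly (interp_coef a f g).

Definition interp_functional (N : nat) (a : 'cV[R[i]]_N.+1) f g : R[i] :=
  cdot (matR N f g *m a) (interp_coef a f g) + cdot (matQ N f g *m a) a.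

Definition observed (N : nat) : pred int :=
  fun j => ~~ ((0 <= j) && (j <= N%:Z)).

Definition observed_span (N : nat) p : Prop :=
  exists (s : seq int) (c : int -> R[i]), all (observed N) s /\
    p = (fun x => \sum_(j <- s) c j * expi (j%:~R * x)).

(* Squared norm in L_2(w). *)
Definition sqnorm w h : \bar R :=
  (\int[mu]_(x in circle) (cmodulus (h x) ^+ 2 * w x)%:E)%E.

(* L_2^N(w). *)
Definition L2N (N : nat) w : set (R -> R[i]) :=
  [set h | [/\ cmeasurable h, (sqnorm w h < +oo)%E &
    forall e : R, 0 < e -> exists p, observed_span N p /\
      (sqnorm w (fun x => (h x - p x)%R) < e%:E)%E]].

Definition Delta (N : nat) (a : 'cV[R[i]]_N.+1) h f g : \bar R :=
  (((2 * pi)^-1)%:E * sqnorm f (fun x => (trigpoly a x - h x)%R)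
   + ((2 * pi)^-1)%:E * sqnorm g h)%E.

(* h = h(f, g).  For spectral densities f, g such an h exists and is unique up
   to equality almost everywhere with respect to (f + g) dx, by the projection
   theorem; Delta does not depend on the representative. *)
Definition spectral_characteristic (N : nat) (a : 'cV[R[i]]_N.+1) f g h : Prop :=
  L2N N (f \+ g) h /\
  forall h', L2N N (f \+ g) h' -> (Delta a h f g <= Delta a h' f g)%E.

Definition least_favourable (N : nat) (a : 'cV[R[i]]_N.+1) f D g0 : Prop :=
  D g0 /\
  exists2 h0, spectral_characteristic a f g0 h0 &
    forall g h, D g -> spectral_characteristic a f g h ->
      (Delta a h f g <= Delta a h0 f g0)%E.

Definition HD (N : nat) f D : set (R -> R[i]) :=
  \bigcap_(g in D) L2N N (f \+ g).

Definition worst_error (N : nat) (a : 'cV[R[i]]_N.+1) f D h : \bar R :=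
  ereal_sup [set Delta a h f g | g in D].

Definition minimax_robust (N : nat) (a : 'cV[R[i]]_N.+1) f D h0 : Prop :=
  HD N f D h0 /\
  forall h, HD N f D h -> (worst_error a f D h0 <= worst_error a f D h)%E.

Definition L1_ball (g1 : R -> R) (eps : R) : set (R -> R) :=
  [set g | spectral_density g /\
    (((2 * pi)^-1)%:E * \int[mu]_(x in circle) `|g x - g1 x|%:E <= eps%:E)%E].

End Interpolation.

(* Main.v *)
Require Import Defs.
From HB Require Import structures.
From mathcomp Require Import all_boot all_order all_algebra.
From mathcomp Require Import all_classical all_reals all_analysis.
From mathcomp Require Import complex measurable_realfun ring lra.

Set Implicit Arguments.
Unset Strict Implicit.
Unset Printing Implicit Defensive.

Import Order.TTheory GRing.Theory Num.Theory.
Import numFieldNormedType.Exports.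

Local Open Scope classical_set_scope.
Local Open Scope ring_scope.
Local Open Scope complex_scope.

(* Write w = f + g0 and h0 = (A f - C) / w.  The Fourier coefficients of h0 of
   index 0..N vanish by the choice of C, and h0 is bounded by alpha2 because
   g0 >= |A f - C| / alpha2 - f.  The Fejer means of a bounded function keep its
   vanishing coefficients, stay bounded and converge in L^1, so that h0 lies in
   L_2^N(f + g) for every spectral density g.  Since h0 w - A f = - C is
   orthogonal to the observed frequencies, Delta(p; f, g0) =
   Delta(h0; f, g0) + (1/2pi) int |p - h0|^2 w, hence h0 minimizes
   Delta(.; f, g0).  Everything then follows from the saddle point inequality
   int |h0|^2 g <= int |h0|^2 g0 on the ball.  It holds when g0 is on the boundary
   of the ball, as |h0| <= alpha2 with equality where g0 > g1.  Otherwise g0 + s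
   is in the ball for some constant s > 0; as the functional to be maximized is
   Delta(h(f, g); f, g), its maximality at g0 gives
   s int |hs|^2 + int |hs - h0|^2 w <= 0 for hs = h(f, g0 + s), hence h0 = 0
   almost everywhere. *)

(** * Real integrals over the circle and almost everywhere statements *)

Section CircleIntegral.
Context {R : realType}.
Implicit Types u v : R -> R.

Local Notation mu := (@lebesgue_measure R).
Local Notation mfun u := (measurable_fun (@circle R) u).

Definition aecirc (P : R -> Prop) : Prop := {ae mu, forall x, circle x -> P x}.

Lemma aecircW P : (forall x, circle x -> P x) -> aecirc P.
Proof. by move=> h; apply: aeW. Qed.

Lemma aecirc_imp (P Q : R -> Prop) : aecirc P ->
  (forall x, circle x -> P x -> Q x) -> aecirc Q.
Proof.
move=> hP PQ; apply: (@filterS _ _ (ae_filter_ringOfSetsType mu) _ _ _ hP).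
by move=> x + cx => /(_ cx); exact: PQ.
Qed.

Lemma aecirc_imp2 (P P' Q : R -> Prop) : aecirc P -> aecirc P' ->
  (forall x, circle x -> P x -> P' x -> Q x) -> aecirc Q.
Proof.
move=> hP hP' PQ.
apply: (@filterS2 _ _ (ae_filter_ringOfSetsType mu) _ _ _ _ hP hP').
by move=> x + + cx => /(_ cx) + /(_ cx); exact: PQ.
Qed.

Definition L1 u : Prop := mu.-integrable circle (EFin \o u).

(** The value is [fine] of the extended integral, hence 0 when that integral is infinite; this is
    why [L1] accompanies the linearity and comparison lemmas. *)
Definition Icirc u : R := \int[mu]_(x in circle) u x.

Lemma measurable_circle : measurable (@circle R).
Proof. exact: measurable_itv. Qed.
Hint Resolve measurable_circle : core.

Lemma mu_circle : mu circle = (2 * pi)%:E.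
Proof.
rewrite /circle lebesgue_measure_itv /= lte_fin.
have := pi_gt0 R => p0; rewrite ifT; last lra.
by rewrite -EFinB; congr EFin; ring.
Qed.

Lemma L1_measurable u : L1 u -> mfun u.
Proof. by move=> /integrableP[/measurable_EFinP]. Qed.

Lemma L1_cst c : L1 (cst c).
Proof.
apply/integrableP; split; first exact/measurable_EFinP.
rewrite (_ : (fun x => _) = cst `|c|%:E)// integral_cst//.
suff: (`|c|%:E * mu circle < +oo)%E by [].
by rewrite mu_circle -EFinM ltry.
Qed.

Lemma L1D u v : L1 u -> L1 v -> L1 (fun x => u x + v x).
Proof. move=> hu hv; exact: (integrableD _ hu hv). Qed.

Lemma L1Z c u : L1 u -> L1 (fun x => c * u x).
Proof. move=> hu; exact: (integrableZl _ c hu). Qed.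

Lemma L1N u : L1 u -> L1 (fun x => - u x).
Proof. by move=> /(L1Z (-1)); congr L1; apply/funext => x; rewrite mulN1r. Qed.

Lemma L1B u v : L1 u -> L1 v -> L1 (fun x => u x - v x).
Proof. by move=> hu /L1N; exact: L1D. Qed.

Lemma L1_norm u : L1 u -> L1 (fun x => `|u x|).
Proof. move=> hu; exact: (integrable_norm hu). Qed.

Lemma L1_sum (T : Type) (s : seq T) (F : T -> R -> R) :
  (forall i, L1 (F i)) -> L1 (fun x => \sum_(i <- s) F i x).
Proof.
move=> hF; elim: s => [|i s ih].
  by under eq_fun do rewrite big_nil; exact: L1_cst.
by under eq_fun do rewrite big_cons; exact: L1D.
Qed.

Lemma L1_dom u v : mfun u -> L1 v -> aecirc (fun x => `|u x| <= v x) -> L1 u.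
Proof.
move=> mu_ hv uv; apply/integrableP; split; first exact/measurable_EFinP.
have /integrableP[mv] := hv; apply: le_lt_trans.
apply: ae_ge0_le_integral => //.
- by do 2 apply: measurableT_comp => //; exact/measurable_EFinP.
- exact: measurableT_comp.
- by apply: (aecirc_imp uv) => x cx le_uv; rewrite lee_fin (le_trans le_uv)// ler_norm.
Qed.

Lemma L1_mul M u v : mfun u -> aecirc (fun x => `|u x| <= M) -> L1 v ->
  L1 (fun x => u x * v x).
Proof.
move=> mu_ uM hv; apply: (@L1_dom _ (fun x => M * `|v x|)).
- by apply: measurable_funM => //; exact: L1_measurable.
- exact/L1Z/L1_norm.
- by apply: (aecirc_imp uM) => x cx le_uM; rewrite normrM ler_wpM2r.
Qed.

Lemma L1_bounded M u : mfun u -> aecirc (fun x => `|u x| <= M) -> L1 u.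
Proof. move=> mu_ uM; exact: L1_dom (L1_cst M) uM. Qed.

Lemma EFin_Icirc u : L1 u -> (Icirc u)%:E = (\int[mu]_(x in circle) (u x)%:E)%E.
Proof. by move=> hu; rewrite fineK//; exact: integrable_fin_num. Qed.

Lemma IcircD u v : L1 u -> L1 v -> Icirc (fun x => u x + v x) = Icirc u + Icirc v.
Proof. by move=> hu hv; exact: RintegralD. Qed.

Lemma IcircB u v : L1 u -> L1 v -> Icirc (fun x => u x - v x) = Icirc u - Icirc v.
Proof. by move=> hu hv; exact: RintegralB. Qed.

Lemma IcircZ c u : L1 u -> Icirc (fun x => c * u x) = c * Icirc u.
Proof. by move=> hu; exact: RintegralZl. Qed.

Lemma Icirc_cst c : Icirc (cst c) = c * (2 * pi).
Proof. by rewrite /Icirc /= Rintegral_cst//; congr (_ * _); exact: (congr1 fine mu_circle). Qed.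

Lemma Icirc_sum (T : Type) (s : seq T) (F : T -> R -> R) :
  (forall i, L1 (F i)) ->
  Icirc (fun x => \sum_(i <- s) F i x) = \sum_(i <- s) Icirc (F i).
Proof.
move=> hF; elim: s => [|i s ih].
  under [in LHS]eq_fun do rewrite big_nil.
  by rewrite big_nil -[RHS](mul0r (2 * pi)) -Icirc_cst.
under [in LHS]eq_fun do rewrite big_cons.
by rewrite big_cons IcircD ?ih//; exact: L1_sum.
Qed.

Lemma Icirc_ge0 u : (forall x, circle x -> 0 <= u x) -> 0 <= Icirc u.
Proof. by move=> u0; apply: fine_ge0; apply: integral_ge0 => x /u0. Qed.

Lemma eq_Icirc_ae u v : mfun u -> mfun v -> aecirc (fun x => u x = v x) ->
  Icirc u = Icirc v.
Proof.
move=> mu_ mv uv; congr fine; apply: ae_eq_integral => //; try exact/measurable_EFinP.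
by apply: (aecirc_imp uv) => x cx ->.
Qed.

Lemma eq_Icirc u v : (forall x, circle x -> u x = v x) -> Icirc u = Icirc v.
Proof. by move=> uv; apply: eq_Rintegral => x /set_mem; exact: uv. Qed.

Lemma ge0_Icirc_ae u : mfun u -> aecirc (fun x => 0 <= u x) -> 0 <= Icirc u.
Proof.
move=> mu_ u0; rewrite (@eq_Icirc_ae _ (fun x => `|u x|))//.
- exact: Icirc_ge0.
- exact: measurableT_comp.
- by apply: (aecirc_imp u0) => x cx ge0u; rewrite ger0_norm.
Qed.

Lemma le_Icirc_ae u v : L1 u -> L1 v -> aecirc (fun x => u x <= v x) ->
  Icirc u <= Icirc v.
Proof.
move=> hu hv uv; rewrite -subr_ge0 -IcircB//; apply: ge0_Icirc_ae.
  by apply: L1_measurable; exact: L1B.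
by apply: (aecirc_imp uv) => x cx le_uv; rewrite subr_ge0.
Qed.

Lemma le_Icirc u v : L1 u -> L1 v -> (forall x, circle x -> u x <= v x) ->
  Icirc u <= Icirc v.
Proof. by move=> hu hv uv; exact: le_Rintegral. Qed.

Lemma normr_Icirc u : L1 u -> `|Icirc u| <= Icirc (fun x => `|u x|).
Proof. by move=> hu; exact: le_normr_Rintegral. Qed.

(** [u] and [|u|] agree almost everywhere, so the integral of [|u|] vanishes too, which forces [u]
    to vanish almost everywhere. *)
Lemma Icirc_eq0 u : L1 u -> aecirc (fun x => 0 <= u x) -> Icirc u <= 0 ->
  aecirc (fun x => u x = 0).
Proof.
move=> hu u0 Iu; have mu_ := L1_measurable hu.
have mn : mfun (fun x => `|u x|) by exact: measurableT_comp.
have Iu' : Icirc (fun x => `|u x|) = 0.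
  apply/eqP; rewrite eq_le Icirc_ge0 ?andbT//.
  rewrite (@eq_Icirc_ae _ u)//.
  by apply: (aecirc_imp u0) => x cx ge0u; rewrite ger0_norm.
have := EFin_Icirc (L1_norm hu); rewrite Iu' => /esym I0.
have mEu : measurable_fun (@circle R) (EFin \o u) by exact/measurable_EFinP.
have [+ _] := ae_eq_integral_abs mu measurable_circle mEu.
by move=> /(_ I0) /aecirc_imp; apply => x cx [].
Qed.

End CircleIntegral.
#[global] Hint Resolve measurable_circle : core.


(** * Complex-valued functions, handled through real and imaginary parts *)

Section ComplexIntegral.
Context {R : realType}.
Implicit Types (h k : R -> R[i]) (z : R[i]).

Local Notation mfun u := (measurable_fun (@circle R) u).
Local Notation Re := complex.Re.
Local Notation Im := complex.Im.

Lemma complexP z z' : Re z = Re z' -> Im z = Im z' -> z = z'.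
Proof. by case: z => a b; case: z' => c d /= -> ->. Qed.

Lemma ReM z z' : Re (z * z') = Re z * Re z' - Im z * Im z'.
Proof. by case: z => a b; case: z' => c d. Qed.

Lemma ImM z z' : Im (z * z') = Re z * Im z' + Im z * Re z'.
Proof. by case: z => a b; case: z' => c d. Qed.

Lemma ReD z z' : Re (z + z') = Re z + Re z'. Proof. exact: raddfD. Qed.
Lemma ImD z z' : Im (z + z') = Im z + Im z'. Proof. exact: raddfD. Qed.
Lemma ReB z z' : Re (z - z') = Re z - Re z'. Proof. exact: raddfB. Qed.
Lemma ImB z z' : Im (z - z') = Im z - Im z'. Proof. exact: raddfB. Qed.

Lemma cmodulus_ge0 z : 0 <= cmodulus z.
Proof. by case: z => a b; rewrite /cmodulus /= sqrtr_ge0. Qed.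

Lemma sqr_cmodulus z : cmodulus z ^+ 2 = Re z ^+ 2 + Im z ^+ 2.
Proof. by case: z => a b; rewrite /cmodulus /= sqr_sqrtr// addr_ge0// sqr_ge0. Qed.

Lemma mulc_conj z : z * z^* = (cmodulus z ^+ 2)%:C.
Proof. by case: z => a b; apply: complexP; rewrite ?ReM ?ImM sqr_cmodulus /=; ring. Qed.

Lemma cmodulusM z z' : cmodulus (z * z') = cmodulus z * cmodulus z'.
Proof. exact: ComplexField.Normc.normcM. Qed.

Lemma cmodulusD z z' : cmodulus (z + z') <= cmodulus z + cmodulus z'.
Proof.
have : (cmodulus (z + z'))%:C <= (cmodulus z)%:C + (cmodulus z')%:C := ler_normD z z'.
by rewrite -rmorphD lecR.
Qed.

Lemma cmodulusN z : cmodulus (- z) = cmodulus z.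
Proof. by case: z => a b; rewrite /cmodulus /= !sqrrN. Qed.

Lemma cmodulusV z : cmodulus z^-1 = (cmodulus z)^-1.
Proof. exact: ComplexField.Normc.normcV. Qed.

Lemma cmodulusR (r : R) : cmodulus r%:C = `|r|.
Proof. by rewrite /cmodulus /= expr0n addr0 sqrtr_sqr. Qed.

Lemma normr_Re_le z : `|Re z| <= cmodulus z.
Proof.
rewrite -[leRHS]ger0_norm ?cmodulus_ge0// -ler_sqr ?nnegrE//.
by rewrite !real_normK ?num_real// sqr_cmodulus lerDl sqr_ge0.
Qed.

Lemma normr_Im_le z : `|Im z| <= cmodulus z.
Proof.
rewrite -[leRHS]ger0_norm ?cmodulus_ge0// -ler_sqr ?nnegrE//.
by rewrite !real_normK ?num_real// sqr_cmodulus lerDr sqr_ge0.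
Qed.

Lemma cmodulus_le z : cmodulus z <= `|Re z| + `|Im z|.
Proof.
have h : 0 <= `|Re z| + `|Im z| by rewrite addr_ge0.
rewrite -ler_sqr ?nnegrE ?cmodulus_ge0// sqr_cmodulus sqrrD.
by rewrite !real_normK ?num_real// -addrA lerD2l lerDr mulrn_wge0// mulr_ge0.
Qed.

Definition cL1 h : Prop := L1 (fun x => Re (h x)) /\ L1 (fun x => Im (h x)).

Lemma cL1_measurable h : cL1 h -> cmeasurable h.
Proof. by case=> /L1_measurable ? /L1_measurable ?. Qed.

Lemma cmeasurableM h k : cmeasurable h -> cmeasurable k ->
  cmeasurable (fun x => h x * k x).
Proof.
move=> [h1 h2] [k1 k2]; split.
- under eq_fun do rewrite ReM.
  by apply: measurable_funB; apply: measurable_funM.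
- under eq_fun do rewrite ImM.
  by apply: measurable_funD; apply: measurable_funM.
Qed.

Lemma cmeasurableD h k : cmeasurable h -> cmeasurable k ->
  cmeasurable (fun x => h x + k x).
Proof.
move=> [h1 h2] [k1 k2]; split.
- by under eq_fun do rewrite ReD; apply: measurable_funD.
- by under eq_fun do rewrite ImD; apply: measurable_funD.
Qed.

Lemma cmeasurableN h : cmeasurable h -> cmeasurable (fun x => - h x).
Proof.
move=> [h1 h2]; split.
- by under eq_fun do rewrite raddfN; apply: measurableT_comp.
- by under eq_fun do rewrite raddfN; apply: measurableT_comp.
Qed.

Lemma cmeasurableB h k : cmeasurable h -> cmeasurable k ->
  cmeasurable (fun x => h x - k x).
Proof. by move=> hh hk; exact: cmeasurableD hh (cmeasurableN hk). Qed.

Lemma cmeasurable_cst z : cmeasurable (cst z).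
Proof. by split; exact: measurable_cst. Qed.

Lemma cmeasurable_conj h : cmeasurable h -> cmeasurable (fun x => (h x)^*%R).
Proof.
move=> [h1 h2]; split.
- have -> : (fun x => Re (h x)^*%R) = (fun x => Re (h x)).
    by apply/funext => x; case: (h x).
  exact: h1.
- have -> : (fun x => Im (h x)^*%R) = (fun x => - Im (h x)).
    by apply/funext => x; case: (h x).
  exact: measurableT_comp.
Qed.

Lemma measurable_sqr_cmodulus h : cmeasurable h -> mfun (fun x => cmodulus (h x) ^+ 2).
Proof.
move=> [h1 h2]; under eq_fun do rewrite sqr_cmodulus.
by apply: measurable_funD; apply: measurable_funX.
Qed.

Lemma cL1_bounded M h : cmeasurable h -> aecirc (fun x => cmodulus (h x) <= M) -> cL1 h.
Proof.
move=> [mh1 mh2] hM; split; apply: (@L1_bounded _ M) => //.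
- by apply: (aecirc_imp hM) => x _; apply: le_trans; exact: normr_Re_le.
- by apply: (aecirc_imp hM) => x _; apply: le_trans; exact: normr_Im_le.
Qed.

Lemma cL1D h k : cL1 h -> cL1 k -> cL1 (fun x => h x + k x).
Proof.
move=> [h1 h2] [k1 k2]; split.
- by under eq_fun do rewrite ReD; apply: L1D.
- by under eq_fun do rewrite ImD; apply: L1D.
Qed.

Lemma cL1B h k : cL1 h -> cL1 k -> cL1 (fun x => h x - k x).
Proof.
move=> [h1 h2] [k1 k2]; split.
- by under eq_fun do rewrite ReB; apply: L1B.
- by under eq_fun do rewrite ImB; apply: L1B.
Qed.

Lemma cL1_mul M h k : cmeasurable h -> aecirc (fun x => cmodulus (h x) <= M) ->
  cL1 k -> cL1 (fun x => h x * k x).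
Proof.
move=> [h1 h2] hM [k1 k2].
have hR : aecirc (fun x => `|Re (h x)| <= M).
  by apply: (aecirc_imp hM) => x _; apply: le_trans; exact: normr_Re_le.
have hI : aecirc (fun x => `|Im (h x)| <= M).
  by apply: (aecirc_imp hM) => x _; apply: le_trans; exact: normr_Im_le.
split.
- under eq_fun do rewrite ReM.
  by apply: L1B; [exact: L1_mul hR _|exact: L1_mul hI _].
- under eq_fun do rewrite ImM.
  by apply: L1D; [exact: L1_mul hR _|exact: L1_mul hI _].
Qed.

Lemma cL1Z z h : cL1 h -> cL1 (fun x => z * h x).
Proof.
apply: (@cL1_mul (cmodulus z) (cst z)); first exact: cmeasurable_cst.
exact: aecircW.
Qed.

Lemma cL1R (u : R -> R) : L1 u -> cL1 (fun x => (u x)%:C).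
Proof. by move=> hu; split => //; exact: L1_cst. Qed.

Lemma cintegralE h : cintegral h =
  Icirc (fun x => Re (h x)) +i* Icirc (fun x => Im (h x)).
Proof. by []. Qed.

Lemma cintegralD h k : cL1 h -> cL1 k ->
  cintegral (fun x => h x + k x) = cintegral h + cintegral k.
Proof.
move=> [h1 h2] [k1 k2]; apply: complexP; rewrite ?ReD ?ImD /= -IcircD//.
- by congr Icirc; apply/funext => x; rewrite ReD.
- by congr Icirc; apply/funext => x; rewrite ImD.
Qed.

Lemma cintegralB h k : cL1 h -> cL1 k ->
  cintegral (fun x => h x - k x) = cintegral h - cintegral k.
Proof.
move=> [h1 h2] [k1 k2]; apply: complexP; rewrite ?ReB ?ImB /= -IcircB//.
- by congr Icirc; apply/funext => x; rewrite ReB.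
- by congr Icirc; apply/funext => x; rewrite ImB.
Qed.

Lemma cintegralZ z h : cL1 h -> cintegral (fun x => z * h x) = z * cintegral h.
Proof.
move=> [h1 h2]; apply: complexP; rewrite ?ReM ?ImM /= -!IcircZ//.
- rewrite -IcircB; [|exact: L1Z..].
  by congr Icirc; apply/funext => x; rewrite ReM.
- rewrite -IcircD; [|exact: L1Z..].
  by congr Icirc; apply/funext => x; rewrite ImM.
Qed.

Lemma cintegral_sum (T : Type) (s : seq T) (F : T -> R -> R[i]) :
  (forall i, cL1 (F i)) ->
  cL1 (fun x => \sum_(i <- s) F i x) /\
  cintegral (fun x => \sum_(i <- s) F i x) = \sum_(i <- s) cintegral (F i).
Proof.
move=> hF; elim: s => [|i s [ih1 ih2]].
  split; first by under eq_fun do rewrite big_nil; split; exact: L1_cst.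
  under [in LHS]eq_fun do rewrite big_nil.
  by rewrite big_nil cintegralE /= !(Icirc_cst 0) !mul0r.
split; first by under eq_fun do rewrite big_cons; exact: cL1D.
by under [in LHS]eq_fun do rewrite big_cons; rewrite big_cons cintegralD// ih2.
Qed.

Lemma cintegralR (u : R -> R) : cintegral (fun x => (u x)%:C) = (Icirc u)%:C.
Proof. by rewrite cintegralE /= (Icirc_cst 0) mul0r. Qed.

Lemma eq_cintegral_ae h k : cmeasurable h -> cmeasurable k ->
  aecirc (fun x => h x = k x) -> cintegral h = cintegral k.
Proof.
move=> [h1 h2] [k1 k2] hk; rewrite !cintegralE; congr (_ +i* _);
  by apply: eq_Icirc_ae => //; apply: (aecirc_imp hk) => x _ ->.
Qed.

End ComplexIntegral.


(** * Exponentials, Fourier coefficients and Toeplitz matrices *)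

Section TrigPolynomials.
Context {R : realType}.
Implicit Types (h : R -> R[i]) (w : R -> R).

Local Notation mfun u := (measurable_fun (@circle R) u).

Lemma measurable_cosf (u : R -> R) : mfun u -> mfun (fun x => cos (u x)).
Proof.
move=> mu_; apply: measurableT_comp => //.
by apply: continuous_measurable_fun; exact: continuous_cos.
Qed.

Lemma measurable_sinf (u : R -> R) : mfun u -> mfun (fun x => sin (u x)).
Proof.
move=> mu_; apply: measurableT_comp => //.
by apply: continuous_measurable_fun; exact: continuous_sin.
Qed.

Lemma expiD (s t : R) : expi (s + t) = expi s * expi t.
Proof.
by apply: complexP; rewrite ?ReM ?ImM /= ?cosD ?sinD// addrC.
Qed.

Lemma conj_expi (t : R) : (expi t)^*%R = expi (- t).
Proof. by rewrite /expi /= cosN sinN. Qed.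

Lemma expi0 : expi 0 = 1 :> R[i].
Proof. by rewrite /expi cos0 sin0. Qed.

Lemma cmodulus_expi (t : R) : cmodulus (expi t) = 1.
Proof. by rewrite /cmodulus /= cos2Dsin2 sqrtr1. Qed.

Lemma cmeasurable_expi (u : R -> R) : mfun u -> cmeasurable (fun x => expi (u x)).
Proof. by move=> mu_; split => /=; [exact: measurable_cosf|exact: measurable_sinf]. Qed.

Lemma measurable_linear (k : R) : mfun (fun x => k * x).
Proof. by apply: measurable_funM. Qed.

Lemma cL1_expiM (u : R -> R) h : mfun u -> cL1 h -> cL1 (fun x => expi (u x) * h x).
Proof.
move=> mu_; apply: (@cL1_mul _ 1); first exact: cmeasurable_expi.
by apply: aecircW => x _; rewrite cmodulus_expi.
Qed.

Lemma sin_intpi (k : int) : sin (k%:~R * pi) = 0 :> R.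
Proof.
have sn (n : nat) : sin (n%:R * pi) = 0 :> R.
  elim: n => [|n ih]; first by rewrite mul0r sin0.
  by rewrite -natr1 mulrDl mul1r sinD ih sinpi mul0r mulr0 addr0.
by case: k => n; rewrite ?NegzE ?mulrNz ?mulNr ?sinN ?sn ?oppr0.
Qed.

(** The primitive [sin (c + k x) / k] takes equal values at both ends of the circle, because
    [sin (k pi) = 0]. The phase [c] covers sines as well, with [c = - (pi / 2)]. *)
Lemma Icirc_cos (c : R) (k : int) : k != 0 -> Icirc (fun x => cos (c + k%:~R * x)) = 0.
Proof.
move=> k0; have kR0 : k%:~R != 0 :> R by rewrite intr_eq0.
pose F x : R := k%:~R^-1 * sin (c + k%:~R * x).
have dF (x : R) : is_derive x (1 : R) F (cos (c + k%:~R * x)).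
  have dg : is_derive x (1 : R) (fun y : R => c + k%:~R * y) k%:~R.
    have -> : (fun y : R => c + k%:~R * y) = cst c + k%:~R *: (@id R) by [].
    by apply: is_derive_eq; rewrite add0r; apply: mulr1.
  have ds := @is_derive1_comp R sin (fun y : R => c + k%:~R * y) x _ _
    (is_derive_sin (c + k%:~R * x)) dg.
  have := is_deriveZ k%:~R^-1 ds; rewrite mulrC.
  have -> : k%:~R^-1 *: (k%:~R * cos (c + k%:~R * x)) = cos (c + k%:~R * x).
    exact: mulKf.
  by [].
have cF x : F z @[z --> x] --> F x.
  by have [/derivable1_diffP/differentiable_continuous] := dF x.
rewrite /Icirc /Rintegral (@continuous_FTC2 _ _ F).
- rewrite /F /= mulrN sinD (sinD c) sinN cosN sin_intpi !mulr0 oppr0 mulr0.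
  by rewrite subrr.
- by have := pi_gt0 R; lra.
- apply: continuous_subspaceT => x; apply: continuous_comp; last exact: continuous_cos.
  by apply: cvgD; [exact: cvg_cst|apply: cvgM; [exact: cvg_cst|exact: cvg_id]].
- split.
  + by move=> x _; have [] := dF x.
  + exact/cvg_at_right_filter/cF.
  + exact/cvg_at_left_filter/cF.
- by move=> x _; rewrite derive1E; have [_ ->] := dF x.
Qed.

Lemma cintegral_expi (k : int) :
  cintegral (fun x : R => expi (k%:~R * x)) = if k == 0 then (2 * pi)%:C else 0.
Proof.
case: eqVneq => [->|k0].
  rewrite -[2 * pi]mul1r -(Icirc_cst 1) -cintegralR; congr cintegral.
  by apply/funext => x; rewrite mul0r expi0.
rewrite cintegralE /=; congr (_ +i* _).
  by rewrite -[RHS](Icirc_cos 0 k0); apply: eq_Icirc => x _; rewrite add0r.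
rewrite -[RHS](Icirc_cos (- (pi / 2)) k0); apply: eq_Icirc => x _.
by rewrite addrC cosBpihalf.
Qed.

(** The Fourier coefficient without its factor [1 / (2 pi)], which is carried by [toeplitz]. *)
Definition fcoef h (j : int) : R[i] := cintegral (fun x => expi (- (j%:~R * x)) * h x).

(** A condition free of any weight, unlike membership of [L2N]. Bounded functions that satisfy it
    will turn out to lie in [L2N N w] for every spectral density [w]. *)
Definition no_low_freq (N : nat) h : Prop :=
  forall j : int, ~~ observed N j -> fcoef h j = 0.

Lemma measurable_Nlinear (k : R) : mfun (fun x => - (k * x)).
Proof. by apply: measurableT_comp => //; exact: measurable_linear. Qed.
Hint Resolve measurable_linear measurable_Nlinear : core.

Lemma cL1_fcoef h (j : int) : cL1 h -> cL1 (fun x => expi (- (j%:~R * x)) * h x).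
Proof. by apply: cL1_expiM. Qed.

Lemma fcoefB h h' j : cL1 h -> cL1 h' ->
  fcoef (fun x => h x - h' x) j = fcoef h j - fcoef h' j.
Proof.
move=> hh hh'; rewrite /fcoef -cintegralB; [|exact: cL1_fcoef..].
by congr cintegral; apply/funext => x; rewrite mulrBr.
Qed.

Lemma no_low_freqB N h h' : cL1 h -> cL1 h' -> no_low_freq N h -> no_low_freq N h' ->
  no_low_freq N (fun x => h x - h' x).
Proof. by move=> lh lh' hh hh' j jN; rewrite fcoefB// hh// hh'// subrr. Qed.

Lemma trigsum_bounded (T : Type) (s : seq T) (c : T -> R[i]) (f : T -> R -> R) :
  exists M, forall x, cmodulus (\sum_(i <- s) c i * expi (f i x)) <= M.
Proof.
exists (\sum_(i <- s) cmodulus (c i)) => x.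
elim/big_rec2: _ => [|i y1 y2 _ le21]; first by rewrite cmodulusR normr0.
apply: le_trans (lerD (lexx _) le21).
rewrite -[cmodulus (c i)]mulr1 -(cmodulus_expi (f i x)) -cmodulusM.
exact: cmodulusD.
Qed.

Lemma trigpoly_bounded N (c : 'cV[R[i]]_N.+1) :
  exists M, forall x, cmodulus (trigpoly c x) <= M.
Proof.
exact: (trigsum_bounded (index_enum 'I_N.+1) (fun j => c j 0) (fun j x => j%:R * x)).
Qed.

Lemma cL1_trigterm (c : R[i]) (k : R) : cL1 (fun x => c * expi (k * x)).
Proof.
apply: cL1Z; apply: (@cL1_bounded _ 1); first exact: cmeasurable_expi.
by apply: aecircW => x _; rewrite cmodulus_expi.
Qed.

Lemma cmeasurable_trigpoly N (c : 'cV[R[i]]_N.+1) : cmeasurable (trigpoly c).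
Proof.
apply: cL1_measurable; rewrite /trigpoly.
by have [] := @cintegral_sum R _ (index_enum 'I_N.+1)
  (fun j x => c j 0 * expi (j%:R * x)) (fun j => cL1_trigterm _ _).
Qed.

Lemma cL1_trigpolyM N (v : 'cV[R[i]]_N.+1) w : L1 w ->
  cL1 (fun x => trigpoly v x * (w x)%:C).
Proof.
move=> hw; have [M hM] := trigpoly_bounded v.
by apply: (@cL1_mul _ M); [exact: cmeasurable_trigpoly|exact: aecircW|exact: cL1R].
Qed.

(** A Toeplitz matrix multiplies the polynomial with coefficients [v] by the symbol and reads the
    coefficients of index 0 to [N]; matrix equations thus become statements about [fcoef]. *)
Lemma toeplitz_mulE N w (v : 'cV[R[i]]_N.+1) (j : 'I_N.+1) : L1 w ->
  (toeplitz N w *m v) j 0 =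
  ((2 * pi)^-1)%:C * fcoef (fun x => trigpoly v x * (w x)%:C) j.
Proof.
move=> hw; rewrite mxE /fcoef.
pose F (k : 'I_N.+1) x := v k 0 * (expi (- ((j%:R - k%:R) * x)) * (w x)%:C).
have -> : (fun x => expi (- ((j : int)%:~R * x)) * (trigpoly v x * (w x)%:C)) =
    (fun x => \sum_(k < N.+1) F k x).
  apply/funext => x; rewrite /trigpoly mulr_suml mulr_sumr; apply: eq_bigr => k _.
  rewrite -[(j : int)%:~R]/(j%:R : R) /F.
  rewrite (_ : - ((j%:R - k%:R) * x) = - (j%:R * x) + k%:R * x); last by ring.
  by rewrite expiD; ring.
have hF k : cL1 (fun x => expi (- ((j%:R - k%:R) * x)) * (w x)%:C).
  by apply: cL1_expiM => //; exact: cL1R.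
have [_ ->] := @cintegral_sum R _ (index_enum 'I_N.+1) F (fun k => cL1Z _ (hF k)).
rewrite mulr_sumr; apply: eq_bigr => k _.
by rewrite mxE cintegralZ//; ring.
Qed.

Lemma conj_trigpoly N (v : 'cV[R[i]]_N.+1) x :
  (trigpoly v x)^*%R = \sum_(j < N.+1) (v j 0)^* * expi (- (j%:R * x)).
Proof.
by rewrite rmorph_sum; apply: eq_bigr => j _; rewrite rmorphM /= -conj_expi.
Qed.

Lemma cintegral_conj_trigpoly N (v : 'cV[R[i]]_N.+1) h : cL1 h ->
  cintegral (fun x => h x * (trigpoly v x)^*) = \sum_(j < N.+1) (v j 0)^* * fcoef h j.
Proof.
move=> hh.
pose F (j : 'I_N.+1) x := (v j 0)^* * (expi (- (j%:R * x)) * h x).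
have -> : (fun x => h x * (trigpoly v x)^*) = (fun x => \sum_(j < N.+1) F j x).
  apply/funext => x; rewrite /= conj_trigpoly mulr_sumr; apply: eq_bigr => j _.
  by rewrite /F; ring.
have hF (j : 'I_N.+1) : cL1 (fun x => expi (- (j%:R * x)) * h x) by exact: cL1_expiM.
have [_ ->] := @cintegral_sum R _ (index_enum 'I_N.+1) F (fun j => cL1Z _ (hF j)).
by apply: eq_bigr => j _; rewrite cintegralZ.
Qed.

Lemma low_freq_ord N (j : 'I_N.+1) : ~~ observed N j.
Proof. by rewrite /observed negbK /= lez_nat -ltnS ltn_ord. Qed.

Lemma no_low_freqP N h : (forall j : 'I_N.+1, fcoef h j = 0) -> no_low_freq N h.
Proof.
move=> h0 [j|j]; rewrite /observed negbK //= lez_nat -ltnS => jN.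
exact: (h0 (Ordinal jN)).
Qed.

Lemma no_low_freq_orthogonal N (v : 'cV[R[i]]_N.+1) h : cL1 h -> no_low_freq N h ->
  cintegral (fun x => h x * (trigpoly v x)^*) = 0.
Proof.
move=> hh h0; rewrite cintegral_conj_trigpoly// big1// => j _.
by rewrite h0 ?mulr0//; exact: low_freq_ord.
Qed.

(** Summing the coefficients against the conjugates of [v] rebuilds the conjugate polynomial under
    the integral. This gives the definiteness of [matB] and turns both terms of [interp_functional]
    into integrals. *)
Lemma cdot_toeplitz N w (v : 'cV[R[i]]_N.+1) : L1 w ->
  cdot (toeplitz N w *m v) v =
  ((2 * pi)^-1 * Icirc (fun x => cmodulus (trigpoly v x) ^+ 2 * w x))%:C.
Proof.
move=> hw; rewrite /cdot.
under eq_bigr => j _ do rewrite toeplitz_mulE// -mulrA (mulrC (fcoef _ _)).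
rewrite -mulr_sumr -cintegral_conj_trigpoly; last exact: cL1_trigpolyM.
rewrite rmorphM /= -cintegralR; congr (_ * cintegral _); apply/funext => x.
by rewrite rmorphM /= -mulc_conj; ring.
Qed.

Lemma L1_sqr_trigpolyM N w (v : 'cV[R[i]]_N.+1) : L1 w ->
  L1 (fun x => cmodulus (trigpoly v x) ^+ 2 * w x).
Proof.
move=> hw; have [M hM] := trigpoly_bounded v.
apply: (@L1_mul _ (M ^+ 2)) => //.
  by apply: measurable_sqr_cmodulus; exact: cmeasurable_trigpoly.
apply: aecircW => x _; rewrite ger0_norm ?sqr_ge0// lerXn2r ?nnegrE ?cmodulus_ge0//.
exact: le_trans (cmodulus_ge0 _) (hM x).
Qed.

Lemma toeplitz1 N : toeplitz N (cst (1 : R)) = 1%:M.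
Proof.
apply/matrixP => j k; rewrite !mxE.
have -> : (fun x : R => expi (- ((j%:R - k%:R) * x)) * (cst 1 x)%:C) =
          (fun x => expi (((k : int) - (j : int))%:~R * x)).
  by apply/funext => x; rewrite /= mulr1 intrD intrN; congr expi; ring.
rewrite cintegral_expi subr_eq0 eqz_nat eq_sym -val_eqE /=.
case: eqP => _; rewrite ?mulr0// -rmorphM /= mulVf// mulf_neq0// ?pnatr_eq0//.
by rewrite gt_eqF// pi_gt0.
Qed.

Lemma trigpoly_eq0 N (v : 'cV[R[i]]_N.+1) : aecirc (fun x => trigpoly v x = 0) -> v = 0.
Proof.
move=> v0; apply/matrixP => j k; rewrite (ord1 k) [RHS]mxE.
rewrite -[v]mul1mx -toeplitz1 toeplitz_mulE; last exact: L1_cst.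
have -> : fcoef (fun x => trigpoly v x * (cst 1 x)%:C) j = 0 :> R[i].
  rewrite /fcoef (@eq_cintegral_ae _ _ (cst 0)).
  - by rewrite (cintegralR (cst 0)) (Icirc_cst 0) mul0r.
  - apply: cmeasurableM; first exact: cmeasurable_expi.
    by apply: cmeasurableM; [exact: cmeasurable_trigpoly|exact: (cmeasurable_cst 1)].
  - exact: cmeasurable_cst.
  - by apply: (aecirc_imp v0) => x _ ->; rewrite mul0r mulr0.
by rewrite mulr0.
Qed.

(** A kernel vector annihilates the quadratic form, an integral of a nonnegative function. As
    [w > 0] almost everywhere, its polynomial vanishes almost everywhere, and so do the
    coefficients. *)
Lemma toeplitz_unitmx N w : L1 w -> aecirc (fun x => 0 < w x) ->
  toeplitz N w \in unitmx.
Proof.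
move=> hw w0; rewrite -unitmx_tr -row_free_unit; apply: inj_row_free => v hv.
have {}hv : toeplitz N w *m v^T = 0 by apply: trmx_inj; rewrite trmx_mul trmxK trmx0.
apply: trmx_inj; rewrite trmx0; apply: trigpoly_eq0.
have := cdot_toeplitz v^T hw; rewrite hv /cdot big1; last first.
  by move=> j _; rewrite mxE mul0r.
move=> /(congr1 (@complex.Re R)) /= /esym /eqP.
rewrite mulf_eq0 invr_eq0 mulf_eq0 pnatr_eq0 /= (gt_eqF (pi_gt0 R)) /= => /eqP I0.
have : aecirc (fun x => cmodulus (trigpoly v^T x) ^+ 2 * w x = 0).
  apply: Icirc_eq0; [exact: L1_sqr_trigpolyM| |by rewrite I0].
  by apply: (aecirc_imp w0) => x _ /ltW wx; rewrite mulr_ge0 ?sqr_ge0.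
move=> /aecirc_imp2 /(_ w0); apply => x _ /eqP + wx.
rewrite mulf_eq0 (gt_eqF wx) orbF expf_eq0 /= => /eqP.
exact: ComplexField.Normc.eq0_normc.
Qed.

End TrigPolynomials.


(** * The Fejer kernel and Fejer means *)

Section FejerKernel.
Context {R : realType}.
Implicit Types (u v : R -> R).

Local Notation mfun u := (measurable_fun (@circle R) u).

Definition fejer_kernel (n : nat) (t : R) : R :=
  n.+1%:R^-1 * cmodulus (\sum_(k < n.+1) expi (k%:R * t)) ^+ 2.

Definition fejer (n : nat) u (x : R) : R :=
  (2 * pi)^-1 * Icirc (fun y => fejer_kernel n (x - y) * u y).

(** Expanding the square in the kernel gives one exponential per pair of indices. Keeping the pairs
    avoids counting how often each frequency occurs; only the diagonal has to be counted. *)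
Definition freq_diff n (p : 'I_n.+1 * 'I_n.+1) : int := (p.1 : int) - (p.2 : int).

Lemma fejer_kernel_ge0 n t : 0 <= fejer_kernel n t.
Proof. by rewrite mulr_ge0 ?sqr_ge0 ?invr_ge0. Qed.

Lemma fejer_kernel_expi n t :
  (fejer_kernel n t)%:C = (n.+1%:R^-1)%:C *
    \sum_(p : 'I_n.+1 * 'I_n.+1) expi ((freq_diff p)%:~R * t).
Proof.
rewrite /fejer_kernel rmorphM /= -mulc_conj; congr (_ * _).
rewrite mulr_suml (eq_bigl (fun p : 'I_n.+1 * 'I_n.+1 => true && true)) //.
rewrite -(pair_big xpredT xpredT (fun k l : 'I_n.+1 => expi ((freq_diff (k, l))%:~R * t))) /=.
apply: eq_bigr => k _; rewrite rmorph_sum mulr_sumr; apply: eq_bigr => l _.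
rewrite /= conj_expi -expiD /freq_diff intrD intrN mulrDl mulNr.
by [].
Qed.

Lemma fejer_kernel_cos n t : fejer_kernel n t =
  n.+1%:R^-1 * \sum_(p : 'I_n.+1 * 'I_n.+1) cos ((freq_diff p)%:~R * t).
Proof.
have /(congr1 (@complex.Re R)) := fejer_kernel_expi n t.
by rewrite ReM /= mul0r subr0 raddf_sum.
Qed.

(** Multiplying the geometric sum by [1 - expi t] gives [1 - expi ((n + 1) t)], and
    [|1 - expi s|^2 = 2 (1 - cos s)]. The left side is thus [(1 - cos ((n + 1) t)) / (n + 1)]. This
    estimate expresses the concentration of the kernel. *)
Lemma fejer_kernel_1Bcos n t : fejer_kernel n t * (1 - cos t) <= 2 / n.+1%:R.
Proof.
have geom m : (1 - expi t) * \sum_(k < m) expi (k%:R * t) = 1 - expi (m%:R * t).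
  elim: m => [|m ih]; first by rewrite big_ord0 mulr0 mul0r expi0 subrr.
  have -> : m.+1%:R * t = m%:R * t + t by rewrite -natr1 mulrDl mul1r.
  by rewrite big_ord_recr /= mulrDr ih expiD; ring.
have sq (s : R) : cmodulus (1 - expi s) ^+ 2 = 2 * (1 - cos s).
  rewrite sqr_cmodulus ReB ImB /=.
  have -> : (1 - cos s) ^+ 2 + (0 - sin s) ^+ 2 = 1 - 2 * cos s + (cos s ^+ 2 + sin s ^+ 2) by ring.
  by rewrite cos2Dsin2; ring.
have := congr1 (fun z => cmodulus z ^+ 2) (geom n.+1).
rewrite /= cmodulusM exprMn !sq => h.
have := cos_geN1 (n.+1%:R * t) => c1.
rewrite /fejer_kernel -mulrA (mulrC 2) ler_pM2l ?invr_gt0// mulrC; lra.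
Qed.

Lemma sum_freq_diff0 n (c : R) :
  \sum_(p : 'I_n.+1 * 'I_n.+1) (if freq_diff p == 0 then c else 0) = n.+1%:R * c.
Proof.
rewrite (eq_bigl (fun p : 'I_n.+1 * 'I_n.+1 => true && true)) //.
rewrite -(pair_big xpredT xpredT (fun k l : 'I_n.+1 => if freq_diff (k, l) == 0 then c else 0)) /=.
rewrite (eq_bigr (fun=> c)) ?sumr_const ?card_ord ?mulr_natl// => k _.
rewrite (bigD1 k)//= /freq_diff subrr eqxx big1 ?addr0// => l lk.
rewrite subr_eq0 eqz_nat ifF//; apply/negbTE; apply: contra lk => /eqP kl.
by apply/eqP/val_inj.
Qed.

Lemma Icirc_cos_int (c : R) (k : int) :
  Icirc (fun x => cos (c + k%:~R * x)) = if k == 0 then 2 * pi * cos c else 0.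
Proof.
case: eqVneq => [->|]; last exact: Icirc_cos.
rewrite mulrC -Icirc_cst; apply: eq_Icirc => x _.
by rewrite mul0r addr0.
Qed.

Lemma L1_cosM (f : R -> R) u : mfun f -> L1 u -> L1 (fun x => cos (f x) * u x).
Proof.
move=> mf; apply: (@L1_mul _ 1); first exact: measurable_cosf.
by apply: aecircW => x _; rewrite ler_norml cos_geN1 cos_le1.
Qed.

Lemma L1_sinM (f : R -> R) u : mfun f -> L1 u -> L1 (fun x => sin (f x) * u x).
Proof.
move=> mf; apply: (@L1_mul _ 1); first exact: measurable_sinf.
by apply: aecircW => x _; rewrite ler_norml sin_geN1 sin_le1.
Qed.

Lemma L1_cos_affine (c k : R) : L1 (fun x => cos (c + k * x)).
Proof.
have -> : (fun x => cos (c + k * x)) = (fun x => cos (c + k * x) * cst 1 x).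
  by apply/funext => x; rewrite mulr1.
apply: L1_cosM; last exact: L1_cst.
by apply: measurable_funD => //; exact: measurable_linear.
Qed.

Lemma L1_fejer_kernelM n x u : L1 u -> L1 (fun y => fejer_kernel n (x - y) * u y).
Proof.
move=> hu; under eq_fun do rewrite fejer_kernel_cos -mulrA mulr_suml.
apply: L1Z; apply: L1_sum => p; apply: L1_cosM => //.
apply: measurable_funM => //; exact: measurable_funB.
Qed.

Lemma Icirc_fejer_kernel n x : Icirc (fun y => fejer_kernel n (x - y)) = 2 * pi.
Proof.
have E y : fejer_kernel n (x - y) = n.+1%:R^-1 * \sum_(p : 'I_n.+1 * 'I_n.+1)
    cos ((freq_diff p)%:~R * x + (- freq_diff p)%:~R * y).
  rewrite fejer_kernel_cos; congr (_ * _); apply: eq_bigr => p _; congr cos.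
  by rewrite intrN; ring.
under eq_Icirc => y _ do rewrite E.
rewrite IcircZ; last by apply: L1_sum => p; exact: L1_cos_affine.
rewrite Icirc_sum; last by move=> p; exact: L1_cos_affine.
rewrite (eq_bigr (fun p : 'I_n.+1 * 'I_n.+1 => if freq_diff p == 0 then 2 * pi else 0)).
  by rewrite sum_freq_diff0 mulKf// pnatr_eq0.
move=> p _; rewrite Icirc_cos_int oppr_eq0; case: eqP => // ->.
by rewrite mul0r cos0 mulr1.
Qed.

Lemma fejer_cst n (c x : R) : fejer n (cst c) x = c.
Proof.
rewrite /fejer; under eq_Icirc => y _ do rewrite mulrC.
rewrite IcircZ ?Icirc_fejer_kernel; last first.
  have -> : (fun y => fejer_kernel n (x - y)) = (fun y => fejer_kernel n (x - y) * cst 1 y).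
    by apply/funext => y; rewrite mulr1.
  by apply: L1_fejer_kernelM; exact: L1_cst.
rewrite mulrC mulfK// mulf_neq0 ?pnatr_eq0// gt_eqF//; exact: pi_gt0.
Qed.

Lemma fejerB n u v x : L1 u -> L1 v ->
  fejer n (fun y => u y - v y) x = fejer n u x - fejer n v x.
Proof.
move=> hu hv; rewrite /fejer -mulrBr -IcircB; [|exact: L1_fejer_kernelM..].
by congr (_ * _); apply: eq_Icirc => y _; rewrite mulrBr.
Qed.

Lemma inv2pi_gt0 : 0 < (2 * pi : R)^-1.
Proof. by rewrite invr_gt0 mulr_gt0// pi_gt0. Qed.

Lemma le_fejer n u v x : L1 u -> L1 v -> aecirc (fun y => u y <= v y) ->
  fejer n u x <= fejer n v x.
Proof.
move=> hu hv uv; rewrite ler_pM2l ?inv2pi_gt0//.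
apply: le_Icirc_ae; [exact: L1_fejer_kernelM..|].
by apply: (aecirc_imp uv) => y _ le_uv; rewrite ler_wpM2l ?fejer_kernel_ge0.
Qed.

Lemma normr_fejer n u x : L1 u -> `|fejer n u x| <= fejer n (fun y => `|u y|) x.
Proof.
move=> hu; rewrite /fejer normrM (gtr0_norm inv2pi_gt0) ler_pM2l ?inv2pi_gt0//.
apply: (le_trans (normr_Icirc (L1_fejer_kernelM n x hu))).
rewrite (@eq_Icirc _ _ (fun y => fejer_kernel n (x - y) * `|u y|))// => y _.
by rewrite normrM (ger0_norm (fejer_kernel_ge0 _ _)).
Qed.

(** Positivity of the kernel and its total mass give a bound that does not depend on [n]. *)
Lemma fejer_bounded n u M x : L1 u -> aecirc (fun y => `|u y| <= M) ->
  `|fejer n u x| <= M.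
Proof.
move=> hu uM; apply: (le_trans (normr_fejer n x hu)).
rewrite -[leRHS](fejer_cst n M x); apply: le_fejer => //; first exact: L1_norm.
exact: L1_cst.
Qed.

(** The addition formula separates [x] from [y], so a Fejer mean is a finite trigonometric sum in
    [x] and can be integrated without exchanging two integrals. The sine is written as a cosine of
    phase [- (pi / 2)], so that the same lemmas treat both terms. *)
Lemma fejer_expand n u x : L1 u -> fejer n u x =
  (2 * pi)^-1 * (n.+1%:R^-1 * \sum_(p : 'I_n.+1 * 'I_n.+1)
    (Icirc (fun y => cos ((freq_diff p)%:~R * y) * u y) * cos (0 + (freq_diff p)%:~R * x) +
     Icirc (fun y => sin ((freq_diff p)%:~R * y) * u y) *
       cos (- (pi / 2) + (freq_diff p)%:~R * x))).
Proof.
move=> hu; congr (_ * _).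
under eq_Icirc => y _ do rewrite fejer_kernel_cos -mulrA mulr_suml.
have ml k : mfun (fun y => k * y) by exact: measurable_linear.
have mlx k : mfun (fun y => k * (x - y)).
  by apply: measurable_funM => //; exact: measurable_funB.
rewrite IcircZ; last by apply: L1_sum => p; exact: L1_cosM.
rewrite Icirc_sum; last by move=> p; exact: L1_cosM.
congr (_ * _); apply: eq_bigr => p _.
rewrite add0r (addrC (- _)) cosBpihalf (mulrC (Icirc _)) (mulrC (Icirc _)).
rewrite -!IcircZ; [|exact: L1_sinM|exact: L1_cosM].
rewrite -IcircD; [|by apply: L1Z; exact: L1_cosM|by apply: L1Z; exact: L1_sinM].
by apply: eq_Icirc => y _; rewrite mulrBr cosB; ring.
Qed.

Lemma L1_fejer n u : L1 u -> L1 (fejer n u).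
Proof.
move=> hu; have -> : fejer n u = fun x => fejer n u x by [].
under eq_fun do rewrite fejer_expand//.
do 2 apply: L1Z; apply: L1_sum => p.
by apply: L1D; apply: L1Z; exact: L1_cos_affine.
Qed.

(** In the expansion only the diagonal pairs survive integration: the cosine of phase 0 gives
    [2 pi], the one of phase [- (pi / 2)] gives 0. *)
Lemma Icirc_fejer n u : L1 u -> Icirc (fejer n u) = Icirc u.
Proof.
move=> hu; rewrite (@eq_Icirc _ _ _ (fun x _ => fejer_expand n x hu)).
have hp (p : 'I_n.+1 * 'I_n.+1) (a b : R) : L1 (fun x =>
    a * cos (0 + (freq_diff p)%:~R * x) + b * cos (- (pi / 2) + (freq_diff p)%:~R * x)).
  by apply: L1D; apply: L1Z; exact: L1_cos_affine.
rewrite IcircZ; last by apply: L1Z; apply: L1_sum => p; exact: hp.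
rewrite IcircZ; last by apply: L1_sum => p; exact: hp.
rewrite Icirc_sum; last by move=> p; exact: hp.
rewrite (eq_bigr (fun p : 'I_n.+1 * 'I_n.+1 =>
    if freq_diff p == 0 then 2 * pi * Icirc u else 0)).
  rewrite sum_freq_diff0 mulKf ?pnatr_eq0// mulKf// mulf_neq0 ?pnatr_eq0//.
  by rewrite gt_eqF// pi_gt0.
move=> p _; rewrite IcircD; [|by apply: L1Z; exact: L1_cos_affine..].
rewrite !IcircZ; [|exact: L1_cos_affine..].
rewrite !Icirc_cos_int; case: eqP => [->|]; last by rewrite !mulr0 addr0.
rewrite cos0 cosN cos_pihalf !mulr0 addr0 mulr1 mulrC; congr (_ * _).
by apply: eq_Icirc => y _; rewrite mul0r cos0 mul1r.
Qed.

(** Follows from [|fejer n u| <= fejer n |u|] and the invariance of the integral. It carries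
    convergence from continuous functions over to all integrable ones. *)
Lemma fejer_contraction n u : L1 u ->
  Icirc (fun x => `|fejer n u x|) <= Icirc (fun x => `|u x|).
Proof.
move=> hu; rewrite -(Icirc_fejer n (L1_norm hu)).
apply: le_Icirc => [||x _]; last exact: normr_fejer.
  exact/L1_norm/L1_fejer.
exact/L1_fejer/L1_norm.
Qed.

End FejerKernel.


(** * Convergence of Fejer means in L^1 *)

Section FejerConvergence.
Context {R : realType}.
Implicit Types (u v : R -> R).

Local Notation mu := (@lebesgue_measure R).
Local Notation mfun u := (measurable_fun (@circle R) u).

Lemma circleE (x : R) : circle x <-> - pi <= x <= pi.
Proof. by rewrite /circle /= in_itv. Qed.

Lemma continuous_bounded_circle v : continuous v ->
  exists M : R, forall x, circle x -> `|v x| <= M.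
Proof.
move=> cv; have pi0 := pi_gt0 R.
have cvn : {within `[- pi, pi : R], continuous (fun x => `|v x|)}.
  apply: continuous_subspaceT => x; apply: continuous_comp; first exact: cv.
  exact: norm_continuous.
have [|c _ hc] := @EVT_max _ (fun x => `|v x|) (- pi) pi _ cvn; first by lra.
by exists `|v c| => x cx; apply: hc; rewrite in_itv; exact/circleE.
Qed.

Lemma continuous_L1 v : continuous v -> L1 v.
Proof.
move=> cv; have [M hM] := continuous_bounded_circle cv.
apply: (@L1_bounded _ M); last exact: aecircW.
by apply: measurable_funTS; exact: continuous_measurable_fun.
Qed.

(** Evenness and [cos (2 pi - t) = cos t] reduce the claim to the decrease of the cosine on
    [[0, pi]]. *)
Lemma cos_le_away (d t : R) : 0 < d -> d <= `|t| -> `|t| <= 2 * pi - d -> cos t <= cos d.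
Proof.
move=> d0 dt td; have pi0 := pi_gt0 R.
have -> : cos t = cos `|t| by case: (ger0P t) => // _; rewrite cosN.
have dpi : d <= pi by lra.
have cos_anti (r : R) : d <= r -> r <= pi -> cos r <= cos d.
  move=> dr rpi; rewrite leNgt ltr_cos ?in_itv /= -?leNgt//; apply/andP; split; lra.
have [tpi|tpi] := leP `|t| pi; first exact: cos_anti.
have -> : cos `|t| = cos (2 * pi - `|t|).
  rewrite cosB (_ : 2 * pi = pi *+ 2); last by rewrite mulr_natl.
  by rewrite cos2pi sin2pi mul1r mul0r addr0.
by apply: cos_anti; lra.
Qed.

(* Korovkin's argument: 1 - cos (x - y), whose Fejer mean at x is O(1/n), is
   bounded below away from y = x. *)
Lemma continuous_modulus v (x e : R) : continuous v -> - pi < x < pi -> 0 < e ->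
  exists C : R, 0 <= C /\
    forall y, circle y -> `|v y - v x| <= e + C * (1 - cos (x - y)).
Proof.
move=> cv xpi e0; have [M hM] := continuous_bounded_circle cv.
have /cvgrPdist_le/(_ _ e0)/nbhs_ballP[d0 /= d0_gt0 hd0] := cv x.
(* The bound [pi - |x|] keeps [|x - y|] at most [2 pi - d] for [y] in the circle, away from the
   other zeros of [1 - cos]. *)
pose d := Num.min d0 (pi - `|x|).
have d_gt0 : 0 < d by rewrite lt_min d0_gt0 subr_gt0 ltr_norml.
have d_le : d <= pi - `|x| by rewrite ge_min lexx orbT.
have dd0 : d <= d0 by rewrite ge_min lexx.
have cosd : cos d < 1.
  have pi0 := pi_gt0 R; have x0 := normr_ge0 x.
  by rewrite -[ltRHS]cos0 ltr_cos ?in_itv /= ?lexx//; apply/andP; split; lra.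
have M0 : 0 <= M by apply: le_trans (hM x _) => //; apply/circleE; lra.
(* For [|x - y| >= d] one has [1 - cos (x - y) >= 1 - cos d], so the second term alone reaches the
   crude bound [2 M]. *)
exists (2 * M / (1 - cos d)); split.
  by rewrite divr_ge0 ?mulr_ge0// subr_ge0 ltW.
move=> y cy; have [yx|xy] := ltP `|x - y| d.
  have := hd0 y; rewrite /ball /= => /(_ (lt_le_trans yx dd0)) h.
  rewrite distrC (le_trans h)// lerDl mulr_ge0// ?subr_ge0 ?cos_le1//.
  by rewrite divr_ge0 ?mulr_ge0// subr_ge0 ltW.
have h1 : `|v y - v x| <= 2 * M.
  apply: (le_trans (ler_normB _ _)).
  have := hM y cy; have : `|v x| <= M by apply: hM; apply/circleE; lra.
  lra.
have h2 : cos (x - y) <= cos d.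
  apply: cos_le_away => //; apply: (le_trans (ler_normB _ _)).
  have : `|y| <= pi by rewrite ler_norml; apply/circleE.
  lra.
apply: (le_trans h1); rewrite -[leLHS]add0r lerD ?(ltW e0)//.
rewrite -mulrA ler_peMr ?mulr_ge0// mulrC ler_pdivlMr ?subr_gt0// mul1r.
by rewrite lerD2l lerN2.
Qed.

(** Constants are preserved, so the error is the mean of [v x - v y]. In the bound of
    [continuous_modulus], the constant term contributes [e / 2] by the mass of the kernel, the other
    at most [2 C / (n + 1)] by [fejer_kernel_1Bcos]. *)
Lemma fejer_cvg_continuous v (x : R) : continuous v -> - pi < x < pi ->
  fejer n v x @[n --> \oo] --> v x.
Proof.
move=> cv xpi; apply/cvgrPdist_lt => e e0.
have [|C [C0 hC]] := @continuous_modulus v x (e / 2) cv xpi; first lra.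
have Lv := continuous_L1 cv.
have L1c (c : R) : L1 (fun=> c) by exact: L1_cst.
have est n : `|v x - fejer n v x| <= e / 2 + C * (2 / n.+1%:R).
  rewrite -{1}(fejer_cst n (v x) x) -fejerB//; last exact: L1_cst.
  have LB : L1 (fun y => cst (v x) y - v y) by apply: L1B => //; exact: L1_cst.
  apply: (le_trans (normr_fejer n x LB)).
  have Lker : L1 (fun y => fejer_kernel n (x - y)).
    have := L1_fejer_kernelM n x (L1c 1).
    by congr L1; apply/funext => y; rewrite mulr1.
  have -> : e / 2 + C * (2 / n.+1%:R) = (2 * pi)^-1 * Icirc (fun y =>
     e / 2 * fejer_kernel n (x - y) + C * (2 / n.+1%:R)).
    rewrite IcircD; [|exact: L1Z|exact: L1c].
    rewrite (IcircZ _ Lker) Icirc_fejer_kernel (Icirc_cst (C * (2 / n.+1%:R))).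
    have : 2 * pi != 0 :> R by rewrite mulf_neq0 ?pnatr_eq0// gt_eqF ?pi_gt0.
    by move=> p0; rewrite -[in RHS]mulrDl [RHS]mulrC mulfK.
  rewrite /fejer ler_pM2l ?inv2pi_gt0//; apply: le_Icirc.
  - exact/L1_fejer_kernelM/L1_norm.
  - by apply: L1D; [exact: L1Z|exact: L1c].
  move=> y cy; rewrite /= distrC.
  apply: (le_trans (ler_wpM2l (fejer_kernel_ge0 _ _) (hC y cy))).
  rewrite mulrDr mulrC lerD2l mulrCA ler_wpM2l//; exact: fejer_kernel_1Bcos.
near=> n; apply: (le_lt_trans (est n)).
suff h : C * (2 / n.+1%:R) < e / 2 by rewrite [ltRHS]splitr ltrD2l.
rewrite mulrA ltr_pdivrMr//.
rewrite -ltr_pdivrMl ?divr_gt0//.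
near: n; have [m _ hm] := nbhs_infty_gtr ((e / 2)^-1 * (C * 2)).
exists m => // n /= mn; apply: (lt_trans (hm n mn)); rewrite ltr_nat.
 exact: ltnSn.
Unshelve. all: by end_near. Qed.

Lemma fejer_L1_continuous v : continuous v ->
  Icirc (fun x => `|v x - fejer n v x|) @[n --> \oo] --> 0.
Proof.
move=> cv; have Lv := continuous_L1 cv.
have [M hM] := continuous_bounded_circle cv.
have mf n : measurable_fun (@circle R) (EFin \o fejer n v).
  by apply/measurable_EFinP; apply: L1_measurable; exact: L1_fejer.
have mv : measurable_fun (@circle R) (EFin \o v).
  by apply/measurable_EFinP; exact: L1_measurable.
have fcv : {ae mu, forall x, circle x -> (EFin \o fejer n v) x @[n --> \oo] --> (EFin \o v) x}.
  (* [v] may take different values at the two end points, so pointwise convergence is proved only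
     inside; the end points form a null set. *)
  exists [set - pi; pi]; split.
  - exact: measurableU.
  - by apply: countable_lebesgue_measure0; exact: finite_set_countable.
  - move=> x /= /not_implyP[/circleE cx ncv].
    apply: contrapT => /not_orP[/eqP n1 /eqP n2]; apply: ncv.
    apply/fine_cvgP; split; first exact: nearW.
    apply: fejer_cvg_continuous => //.
    move: cx => /andP[c1 c2]; rewrite !lt_neqAle c1 c2 n2 eq_sym n1//.
have fb : {ae mu, forall x n, circle x -> (`|(EFin \o fejer n v) x| <= (cst M%:E) x)%E}.
  apply: aeW => x n cx; rewrite lee_fin; apply: fejer_bounded => //.
  exact: aecircW.
have [_ h _] := @dominated_convergence _ _ _ mu _ measurable_circle
   (fun n => EFin \o fejer n v) (EFin \o v) (cst M%:E) mf mv fcv (L1_cst M) fb.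
apply: cvg_trans (fine_cvg h); apply: near_eq_cvg; apply: nearW => n.
by apply: eq_Icirc => x _; rewrite distrC.
Qed.

Lemma L1_continuous_dense u (e : R) : L1 u -> 0 < e ->
  exists v, continuous v /\ Icirc (fun x => `|u x - v x|) < e.
Proof.
move=> Lu e0.
have muc : (mu circle < +oo)%E by rewrite [mu circle]mu_circle ltry.
have [v [cv _ hv]] := approximation_continuous_integrable measurable_circle muc Lu.
have /fine_cvg/cvgrPdist_lt/(_ e e0)[m _ /(_ m (leqnn m))] :
  (\int[mu]_(z in circle) `|(u z - v n z)%:E|)%E @[n --> \oo] --> (0 : R)%:E by exact: hv.
rewrite sub0r normrN => hm; exists (v m); split => //.
exact: le_lt_trans (ler_norm _) hm.
Qed.

(** Take a continuous function at distance below [e / 4] from [u]. By contraction this costs at most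
    [e / 4] twice, and the error of the continuous function is eventually below [e / 4]. *)
Lemma fejer_L1 u : L1 u -> Icirc (fun x => `|u x - fejer n u x|) @[n --> \oo] --> 0.
Proof.
move=> Lu; apply/cvgrPdist_lt => e e0.
have [|w [cw hm]] := @L1_continuous_dense u (e / 4) Lu; first by lra.
have Lw := continuous_L1 cw.
have /cvgrPdist_lt/(_ (e / 4)) := fejer_L1_continuous cw.
have -> : 0 < e / 4 by lra.
move=> /(_ isT); apply: filterS => n; rewrite !sub0r !normrN.
rewrite !ger0_norm; [|exact: Icirc_ge0..] => hn.
have LB : L1 (fun x => u x - w x) by exact: L1B.
have Lfw := L1_fejer n Lw; have Lfu := L1_fejer n Lu; have LfB := L1_fejer n LB.
have := fejer_contraction n LB => hc.
have LD : L1 (fun x => `|w x - fejer n w x|) by apply: L1_norm; exact: L1B.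
have LN : L1 (fun x => `|u x - w x|) by exact: L1_norm.
have LC : L1 (fun x => `|fejer n (fun x => u x - w x) x|) by exact: L1_norm.
apply: (@le_lt_trans _ _ (Icirc (fun x => `|u x - w x| + (`|w x - fejer n w x| +
   `|fejer n (fun x => u x - w x) x|)))).
  apply: le_Icirc; [by apply: L1_norm; exact: L1B|by apply: L1D => //; exact: L1D|].
  move=> x _; rewrite fejerB//.
  have -> : u x - fejer n u x = (u x - w x) + ((w x - fejer n w x) -
     (fejer n u x - fejer n w x)) by ring.
  apply: (le_trans (ler_normD _ _)); rewrite lerD2l.
  exact: ler_normB.
by rewrite !IcircD//; [lra|exact: L1D].
Qed.

Lemma near_fejer_L1 u (d : R) : L1 u -> 0 < d ->
  \forall n \near \oo, Icirc (fun x => `|u x - fejer n u x|) < d.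
Proof.
move=> Lu d0; have /cvgrPdist_lt/(_ d d0) := fejer_L1 Lu.
apply: filterS => n; rewrite sub0r normrN; apply: le_lt_trans; exact: ler_norm.
Qed.

End FejerConvergence.


(** * Bounded functions in the space of observed frequencies *)

Section ObservedSpace.
Context {R : realType}.
Implicit Types (h : R -> R[i]) (w : R -> R).

Local Notation mu := (@lebesgue_measure R).
Local Notation Re := complex.Re.
Local Notation Im := complex.Im.

#[local] Opaque Icirc fejer.

Definition cfejer n h (x : R) : R[i] :=
  fejer n (fun y => Re (h y)) x +i* fejer n (fun y => Im (h y)) x.

(** Each frequency of a Fejer mean carries a multiple of the corresponding Fourier coefficient of
    [h], so a vanishing coefficient stays absent. *)
Lemma cfejerE n h x : cL1 h -> cfejer n h x = ((2 * pi)^-1)%:C * (n.+1%:R^-1)%:C *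
  \sum_(p : 'I_n.+1 * 'I_n.+1) fcoef h (freq_diff p) * expi ((freq_diff p)%:~R * x).
Proof.
move=> hh.
have -> : cfejer n h x = ((2 * pi)^-1)%:C * cintegral (fun y => (fejer_kernel n (x - y))%:C * h y).
  apply: complexP; rewrite ?ReM ?ImM /= ?mul0r ?subr0 ?addr0; [
    transitivity ((2 * pi)^-1 * Icirc (fun y => fejer_kernel n (x - y) * Re (h y)))|
    transitivity ((2 * pi)^-1 * Icirc (fun y => fejer_kernel n (x - y) * Im (h y)))];
    rewrite //; congr (_ * _).
  - by apply: eq_Icirc => y _; rewrite ReM /= mul0r subr0.
  - by apply: eq_Icirc => y _; rewrite ImM /= mul0r addr0.
rewrite -mulrA; congr (_ * _).
pose F (p : 'I_n.+1 * 'I_n.+1) y :=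
  ((n.+1%:R^-1)%:C * expi ((freq_diff p)%:~R * x)) * (expi (- ((freq_diff p)%:~R * y)) * h y).
have -> : (fun y => (fejer_kernel n (x - y))%:C * h y) = (fun y => \sum_p F p y).
  apply/funext => y; rewrite fejer_kernel_expi mulr_sumr mulr_suml; apply: eq_bigr => p _.
  by rewrite /F mulrBr expiD; ring.
have hF p : cL1 (F p) by apply: cL1Z; exact: cL1_fcoef.
have [_ ->] := @cintegral_sum R _ (index_enum _) F hF.
rewrite mulr_sumr; apply: eq_bigr => p _.
by rewrite cintegralZ ?/fcoef; [ring|exact: cL1_fcoef].
Qed.

Lemma observed_span_cfejer N n h : cL1 h -> no_low_freq N h ->
  observed_span N (cfejer n h).
Proof.
move=> hh h0.
exists [seq freq_diff p | p <- enum [pred p : 'I_n.+1 * 'I_n.+1 | observed N (freq_diff p)]].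
exists (fun j => ((2 * pi)^-1)%:C * (n.+1%:R^-1)%:C * fcoef h j); split.
  by apply/allP => j /mapP[p]; rewrite mem_enum => pN ->.
apply/funext => x; rewrite cfejerE// mulr_sumr big_map big_enum /=.
rewrite [RHS]big_mkcond /=; apply: eq_bigr => p _.
case: ifPn => [_|pN]; first by ring.
by rewrite h0// mul0r mulr0.
Qed.

Lemma sqnormE w h : L1 (fun x => cmodulus (h x) ^+ 2 * w x) ->
  sqnorm w h = (Icirc (fun x => cmodulus (h x) ^+ 2 * w x))%:E.
Proof. by move=> hw; rewrite EFin_Icirc. Qed.

Lemma L1_sqnorm K w h : cmeasurable h -> aecirc (fun x => cmodulus (h x) <= K) ->
  L1 w -> L1 (fun x => cmodulus (h x) ^+ 2 * w x).
Proof.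
move=> mh hK hw; apply: (@L1_mul _ (K ^+ 2)) => //.
  exact: measurable_sqr_cmodulus.
apply: (aecirc_imp hK) => x _ hx; rewrite ger0_norm ?sqr_ge0//.
by rewrite lerXn2r ?nnegrE ?cmodulus_ge0// (le_trans _ hx)// cmodulus_ge0.
Qed.

(** The Fejer means [p] of [h] lie in the observed span. The weight, merely integrable, is dominated
    by [|w - v| + (M + 1)] with [v] continuous: against [|w - v|] the uniform bound on [h - p] is
    enough, against the constant the L^1 convergence is. *)
Lemma bounded_L2N N K w h : cmeasurable h -> aecirc (fun x => cmodulus (h x) <= K) ->
  no_low_freq N h -> spectral_density w -> L2N N w h.
Proof.
move=> mh hK h0 [w0 Lw]; have {}Lw : L1 w by exact: Lw.
wlog K0 : K hK / 0 < K.
  move=> /(_ (`|K| + 1)); apply; last by rewrite ltr_wpDl.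
  apply: (aecirc_imp hK) => x _ /le_trans; apply.
  by rewrite (le_trans (ler_norm _))// lerDl.
have Lh := cL1_bounded mh hK; have [LR LI] := Lh.
split => //; first by rewrite sqnormE ?ltry//; exact: L1_sqnorm hK Lw.
move=> e e0.
(* Since [|h - p|^2 <= 8 K^2], this precision keeps the part weighted by [|w - v|] below [e / 2]. *)
have [|v [cv hv]] := @L1_continuous_dense R w (e / (16 * K ^+ 2)) Lw.
  by rewrite divr_gt0// mulr_gt0// exprn_gt0.
have [M hM] := continuous_bounded_circle cv.
have M0 : 0 <= M.
  apply: le_trans (hM 0 _) => //; apply/circleE.
  by have := pi_gt0 R; lra.
have Lv := continuous_L1 cv.
(* [d] is the L^1 precision asked of the real and of the imaginary part. As [|h - p|^2] is at most
   [2 K] times the sum of their absolute errors, the part with weight [M + 1] stays below [e / 2];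
   the 1 added to [M] makes the divisor positive. *)
have [d [d0 dE]] : exists d, 0 < d /\ 2 * K * (M + 1) * (d + d) = e / 2.
  exists (e / (8 * K * (M + 1))); split; first by rewrite divr_gt0 ?mulr_gt0//; lra.
  by field; rewrite !gt_eqF//; lra.
have [n [hR hI]] := filter_ex (filterI (near_fejer_L1 LR d0) (near_fejer_L1 LI d0)).
exists (cfejer n h); split; first exact: observed_span_cfejer.
have Re_le : aecirc (fun x => `|Re (h x)| <= K).
  by apply: (aecirc_imp hK) => x _; apply: le_trans; exact: normr_Re_le.
have Im_le : aecirc (fun x => `|Im (h x)| <= K).
  by apply: (aecirc_imp hK) => x _; apply: le_trans; exact: normr_Im_le.
have Lfc : cL1 (cfejer n h) by split => /=; exact: L1_fejer.
pose D x := h x - cfejer n h x.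
have LD : cL1 D by exact: cL1B.
pose a x := `|Re (D x)|; pose b x := `|Im (D x)|.
have sqD x : cmodulus (D x) ^+ 2 = a x ^+ 2 + b x ^+ 2.
  by rewrite sqr_cmodulus /a /b !real_normK ?num_real.
have Da : aecirc (fun x => a x <= 2 * K).
  apply: (aecirc_imp Re_le) => x _ hx; rewrite /a /D ReB /=.
  apply: (le_trans (ler_normB _ _)).
  have := fejer_bounded n x LR Re_le; lra.
have Db : aecirc (fun x => b x <= 2 * K).
  apply: (aecirc_imp Im_le) => x _ hx; rewrite /b /D ImB /=.
  apply: (le_trans (ler_normB _ _)).
  have := fejer_bounded n x LI Im_le; lra.
have DK : aecirc (fun x => cmodulus (D x) <= 4 * K).
  apply: (aecirc_imp2 Da Db) => x _ ha hb.
  by apply: (le_trans (cmodulus_le _)); rewrite -/(a x) -/(b x); lra.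
have LDw := L1_sqnorm (cL1_measurable LD) DK Lw.
rewrite sqnormE// lte_fin.
have La : L1 a by apply: L1_norm; case: LD.
have Lb : L1 b by apply: L1_norm; case: LD.
have Lwv : L1 (fun x => `|w x - v x|) by apply: L1_norm; exact: L1B.
have Lab : L1 (fun x => a x + b x) by exact: L1D.
apply: (@le_lt_trans _ _ (Icirc (fun x => 8 * K ^+ 2 * `|w x - v x| +
    (2 * K * (M + 1)) * (a x + b x)))).
  apply: le_Icirc_ae => //; first by apply: L1D; exact: L1Z.
  apply: (aecirc_imp2 Da Db) => x cx ha hb; rewrite -/(D x) sqD.
  have a0 : 0 <= a x by exact: normr_ge0.
  have b0 : 0 <= b x by exact: normr_ge0.
  have a2 : a x ^+ 2 <= 2 * K * a x by rewrite expr2 ler_wpM2r.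
  have b2 : b x ^+ 2 <= 2 * K * b x by rewrite expr2 ler_wpM2r.
  have s2 : a x ^+ 2 + b x ^+ 2 <= 2 * K * (a x + b x) by lra.
  have s8 : a x ^+ 2 + b x ^+ 2 <= 8 * K ^+ 2 by nra.
  have s0 : 0 <= a x ^+ 2 + b x ^+ 2 by rewrite addr_ge0 ?sqr_ge0.
  have wv : w x <= `|w x - v x| + (M + 1).
    by have := hM x cx; have := ler_norm (v x); have := ler_norm (w x - v x); lra.
  apply: (le_trans (ler_wpM2l s0 wv)); rewrite mulrDr; apply: lerD.
    by rewrite ler_wpM2r.
  by rewrite mulrAC ler_wpM2r//; lra.
rewrite IcircD; [|exact: L1Z..]; rewrite !IcircZ// IcircD//.
have h1 : 8 * K ^+ 2 * Icirc (fun x => `|w x - v x|) < e / 2.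
  move: hv; rewrite ltr_pdivlMr ?mulr_gt0 ?exprn_gt0//; lra.
have h2 : 2 * K * (M + 1) * (Icirc a + Icirc b) < e / 2.
  have ha : Icirc a < d by move: hR; congr (_ < _); apply: eq_Icirc => x _; rewrite /a ReB.
  have hb : Icirc b < d by move: hI; congr (_ < _); apply: eq_Icirc => x _; rewrite /b ImB.
  apply: (@lt_le_trans _ _ (2 * K * (M + 1) * (d + d))).
    by rewrite ltr_pM2l; [exact: ltrD|rewrite !mulr_gt0//; lra].
  by rewrite dE.
lra.
Qed.

Lemma observed_spanP N (p : R -> R[i]) : observed_span N p ->
  [/\ cmeasurable p, (exists K, forall x, cmodulus (p x) <= K) & no_low_freq N p].
Proof.
move=> [s [c [sN ->]]].
pose F (j : int) x := c j * expi (j%:~R * x).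
have hF j : cL1 (F j) by exact: cL1_trigterm.
have [Lp _] := @cintegral_sum R _ s F hF.
split; first exact: cL1_measurable.
- exact: (trigsum_bounded s c (fun j x => j%:~R * x)).
move=> k kN; rewrite /fcoef.
pose G (j : int) x := c j * expi ((j - k)%:~R * x).
have -> : (fun x => expi (- (k%:~R * x)) * (\sum_(j <- s) c j * expi (j%:~R * x))) =
    (fun x => \sum_(j <- s) G j x).
  apply/funext => x; rewrite mulr_sumr; apply: eq_bigr => j _.
  by rewrite /G intrD intrN mulrDl mulNr expiD; ring.
have hG j : cL1 (G j) by exact: cL1_trigterm.
have [_ ->] := @cintegral_sum R _ s G hG.
rewrite big_seq big1// => j js.
rewrite cintegralZ; last first.
  have -> : (fun x : R => expi ((j - k)%:~R * x)) = (fun x => 1 * expi ((j - k)%:~R * x)).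
    by apply/funext => x; rewrite mul1r.
  exact: cL1_trigterm.
rewrite cintegral_expi subr_eq0 ifF ?mulr0//; apply/negbTE.
by apply: contra kN => /eqP <-; exact: (allP sN).
Qed.

End ObservedSpace.


(** * The optimal spectral characteristic and its error *)

Section OptimalEstimate.
Context {R : realType}.
Implicit Types (f g u v : R -> R) (h p : R -> R[i]).

Local Notation mu := (@lebesgue_measure R).
Local Notation mfun u := (measurable_fun (@circle R) u).
Local Notation Re := complex.Re.
Local Notation Im := complex.Im.

#[local] Opaque Icirc.

Lemma spectral_L1 f : spectral_density f -> L1 f.
Proof. by case. Qed.

Lemma spectral_densityD f g : spectral_density f -> spectral_density g ->
  spectral_density (f \+ g).
Proof.
move=> [f0 Lf] [g0 Lg]; split; last exact: L1D.
by move=> x cx; rewrite addr_ge0 ?f0 ?g0.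
Qed.

Lemma measurable_inv u : mfun u -> (forall x, circle x -> 0 <= u x) ->
  mfun (fun x => (u x)^-1).
Proof.
(* The real power [-1] is measurable and agrees with the inverse on nonnegative reals, including at
   0, where both are 0. *)
move=> mu_ u0; apply: (@eq_measurable_fun _ _ _ _ _ (fun x => u x `^ (-1))).
  by move=> x /set_mem cx; rewrite powR_inv1// u0.
by apply: (measurableT_comp (measurable_powR (-1)) mu_).
Qed.

(** The extended inverse is [+oo] where [f + g] vanishes, so a finite integral makes that set null.
    The field inverse is dominated by the extended one, being 0 at the zeros and equal elsewhere. *)
Lemma minimalityP f g : spectral_density f -> spectral_density g -> minimality f g ->
  aecirc (fun x => 0 < f x + g x) /\ L1 (fun x => 1 / (f x + g x)).
Proof.
move=> sf sg hm; have [w0 Lw] := spectral_densityD sf sg.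
have mw : mfun (f \+ g) by exact: L1_measurable.
pose F x := (((f \+ g) x)%:E^-1)%E.
have mV : mfun (fun x => ((f \+ g) x)^-1) by exact: measurable_inv.
have mF : measurable_fun (@circle R) F.
  rewrite /F; under eq_fun do rewrite inver.
  apply: measurable_fun_if => //.
  - exact: measurable_circle.
  - apply: (measurable_fun_bool true).
    rewrite (_ : _ @^-1` _ = (f \+ g) @^-1` [set 0]).
      by apply: mw; [exact: measurable_circle|exact: measurable_set1].
    by apply/seteqP; split=> x /= /eqP.
  - by apply/measurable_EFinP; apply: (measurable_funS measurable_circle _ mV); exact: subIsetl.
have F0 x : circle x -> (0 <= F x)%E.
  by move=> cx; rewrite inve_ge0 lee_fin w0.
have iF : mu.-integrable circle F.
  apply/integrableP; split => //.
  by under eq_integral => x /set_mem cx do rewrite gee0_abs ?F0//.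
have aeF : {ae mu, forall x, circle x -> F x \is a fin_num}.
  apply: integrable_ae iF; exact: measurable_circle.
have aew : aecirc (fun x => 0 < f x + g x).
  apply: (@aecirc_imp _ (fun x => F x \is a fin_num)); first exact: aeF.
  move=> x cx; rewrite /F inver; case: eqP => // /eqP n0 _.
  by rewrite lt_neqAle eq_sym n0 w0.
split => //; apply/integrableP; split.
  by apply/measurable_EFinP; under eq_fun do rewrite div1r.
case/integrableP: iF => _; apply: le_lt_trans; apply: ge0_le_integral => //.
- exact: measurable_circle.
- apply: measurableT_comp => //; apply/measurable_EFinP.
  by under eq_fun do rewrite div1r.
- exact: measurableT_comp.
- move=> x cx; rewrite /F inver /=; case: eqP => [/= ->|_]; first by rewrite leey.
  by rewrite div1r.
Qed.

Lemma spectral_quotient_le1 f g x : spectral_density f -> spectral_density g ->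
  circle x -> 0 <= f x / (f x + g x) <= 1.
Proof.
move=> [f0 _] [g0 _] cx; rewrite divr_ge0 ?addr_ge0 ?f0 ?g0//=.
have [->|w0] := eqVneq (f x + g x) 0; first by rewrite invr0 mulr0.
by rewrite ler_pdivrMr ?mul1r ?lerDl ?g0// lt_neqAle eq_sym w0 addr_ge0 ?f0 ?g0.
Qed.

Lemma measurable_quotient f g : spectral_density f -> spectral_density g ->
  mfun (fun x => f x / (f x + g x)).
Proof.
move=> sf sg; apply: measurable_funM; first by apply: L1_measurable; exact: spectral_L1.
have [w0 Lw] := spectral_densityD sf sg.
by apply: measurable_inv => //; exact: L1_measurable.
Qed.

Lemma L1_quotient f g : spectral_density f -> spectral_density g ->
  L1 (fun x => f x / (f x + g x)).
Proof.
move=> sf sg; apply: (@L1_bounded _ 1); first exact: measurable_quotient.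
apply: aecircW => x cx; have /andP[q0 q1] := spectral_quotient_le1 sf sg cx.
by rewrite ger0_norm.
Qed.

Lemma L1_harmonic f g : spectral_density f -> spectral_density g ->
  L1 (fun x => f x * g x / (f x + g x)).
Proof.
move=> sf sg.
have -> : (fun x => f x * g x / (f x + g x)) = (fun x => f x / (f x + g x) * g x).
  by apply/funext => x; rewrite mulrAC.
apply: (@L1_mul _ 1); [exact: measurable_quotient| |exact: spectral_L1].
apply: aecircW => x cx; have /andP[q0 q1] := spectral_quotient_le1 sf sg cx.
by rewrite ger0_norm.
Qed.

(** The candidate for [h(f, g)]. The quotient is 0 where [f + g] vanishes, which under [minimality]
    happens only on a null set. *)
Definition optimal_char N (a : 'cV[R[i]]_N.+1) f g (x : R) : R[i] :=
  (trigpoly a x * (f x)%:C - interp_poly a f g x) / (f x + g x)%:C.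

Lemma optimal_charE N (a : 'cV[R[i]]_N.+1) f g x : optimal_char a f g x =
  trigpoly a x * (f x / (f x + g x))%:C - interp_poly a f g x * (1 / (f x + g x))%:C.
Proof. by rewrite /optimal_char !rmorphM !fmorphV /= rmorph1 mul1r mulrBl mulrA. Qed.

Lemma sqrM_ge0 (r s : R) : 0 <= s -> 0 <= r ^+ 2 * s.
Proof. by move=> s0; rewrite mulr_ge0 ?sqr_ge0. Qed.

(** Young's inequality, from [(t b - c)^2 / t >= 0]. With a small [t] it replaces the triangle
    inequality of the weighted norm. *)
Lemma sqr_cmodulusD_le (t : R) (z z' : R[i]) : 0 < t ->
  cmodulus (z + z') ^+ 2 <= (1 + t) * cmodulus z ^+ 2 + (1 + t^-1) * cmodulus z' ^+ 2.
Proof.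
move=> t0; have real_le (b c : R) : (b + c) ^+ 2 <= (1 + t) * b ^+ 2 + (1 + t^-1) * c ^+ 2.
  have : 0 <= t^-1 * (t * b - c) ^+ 2 by rewrite mulr_ge0 ?sqr_ge0// invr_ge0 ltW.
  have -> : t^-1 * (t * b - c) ^+ 2 =
      (1 + t) * b ^+ 2 + (1 + t^-1) * c ^+ 2 - (b + c) ^+ 2.
    by field; rewrite gt_eqF.
  by rewrite subr_ge0.
rewrite !sqr_cmodulus ReD ImD; have := real_le (Re z) (Re z').
have := real_le (Im z) (Im z'); lra.
Qed.

Lemma sqnorm_lty_L1 u h : cmeasurable h -> L1 u -> (forall x, circle x -> 0 <= u x) ->
  (sqnorm u h < +oo)%E -> L1 (fun x => cmodulus (h x) ^+ 2 * u x).
Proof.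
move=> mh Lu u0 hu; apply/integrableP; split.
  apply/measurable_EFinP; apply: measurable_funM; last exact: L1_measurable.
  exact: measurable_sqr_cmodulus.
move: hu; congr (_ < _)%E; apply: eq_integral => x /set_mem cx.
by rewrite gee0_abs// lee_fin sqrM_ge0 ?u0.
Qed.

Section Optimal.
Variables (N : nat) (a : 'cV[R[i]]_N.+1) (f g : R -> R).
Hypotheses (sf : spectral_density f) (sg : spectral_density g).
Hypothesis hm : minimality f g.

Let w x := f x + g x.
Let A := trigpoly a.
Let C := interp_poly a f g.
Let h0 := optimal_char a f g.

Lemma cL1_optimal_char : cL1 h0.
Proof.
have [_ LV] := minimalityP sf sg hm.
rewrite (_ : h0 = fun x => A x * (f x / w x)%:C - C x * (1 / w x)%:C); last first.
  by apply/funext => x; exact: optimal_charE.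
by apply: cL1B; apply: cL1_trigpolyM => //; exact: L1_quotient.
Qed.

Lemma matB_unit : matB N f g \in unitmx.
Proof.
have [aew LV] := minimalityP sf sg hm; apply: toeplitz_unitmx => //.
by apply: (aecirc_imp aew) => x _ wx; rewrite div1r invr_gt0.
Qed.

(** Up to the factor [2 pi], the coefficients of index 0 to [N] form the vector
    [R a - B (B^-1 R a)], which is zero as [B] is invertible. *)
Lemma no_low_freq_optimal_char : no_low_freq N h0.
Proof.
have [_ LV] := minimalityP sf sg hm; have Lq := L1_quotient sf sg.
apply: no_low_freqP => j.
rewrite (_ : h0 = fun x => A x * (f x / w x)%:C - C x * (1 / w x)%:C); last first.
  by apply/funext => x; exact: optimal_charE.
rewrite fcoefB; [|exact: cL1_trigpolyM..].
have p0 : ((2 * pi)^-1)%:C != 0 :> R[i].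
  by rewrite eq_complex /= eqxx andbT gt_eqF// inv2pi_gt0.
apply: (mulfI p0); rewrite mulr0 mulrBr -!toeplitz_mulE//.
by rewrite -/(matR N f g) -/(matB N f g) /interp_coef mulKVmx ?subrr// matB_unit.
Qed.

(** The integrand of [2 pi Delta]. The densities are parameters because the same function is later
    evaluated under two noise densities. *)
Definition err h u v (x : R) : R :=
  cmodulus (A x - h x) ^+ 2 * u x + cmodulus (h x) ^+ 2 * v x.

Lemma bounded_err K h u v : cmeasurable h -> aecirc (fun x => cmodulus (h x) <= K) ->
  L1 u -> L1 v ->
  [/\ L1 (fun x => cmodulus (A x - h x) ^+ 2 * u x),
      L1 (fun x => cmodulus (h x) ^+ 2 * v x), L1 (err h u v) &
      Delta a h u v = ((2 * pi)^-1 * Icirc (err h u v))%:E].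
Proof.
move=> mh hK Lu Lv; have [M hM] := trigpoly_bounded a.
have L2 := L1_sqnorm mh hK Lv.
have L3 : L1 (fun x => cmodulus (A x - h x) ^+ 2 * u x).
  apply: (@L1_sqnorm _ (M + K)) => //.
    by apply: cmeasurableB => //; exact: cmeasurable_trigpoly.
  apply: (aecirc_imp hK) => x _ hx; apply: (le_trans (cmodulusD _ _)).
  by rewrite lerD ?hM// cmodulusN.
split => //; first exact: L1D.
by rewrite /Delta !sqnormE// -!EFinM -EFinD -mulrDr -IcircD.
Qed.

(** With [d = p - h0], the integrands of the two sides differ by [2 Re (d conj C)], because
    [C = A f - h0 w] where [w > 0]. This term integrates to 0, as [C] has only frequencies 0 to [N]
    and [d] has none of them. *)
Lemma optimal_char_pythagoras K K' p :
  aecirc (fun x => cmodulus (h0 x) <= K) ->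
  cmeasurable p -> aecirc (fun x => cmodulus (p x) <= K') -> no_low_freq N p ->
  L1 (fun x => cmodulus (p x - h0 x) ^+ 2 * w x) /\
  Icirc (err p f g) = Icirc (err h0 f g) + Icirc (fun x => cmodulus (p x - h0 x) ^+ 2 * w x).
Proof.
move=> hK mp pK p0; have [aew _] := minimalityP sf sg hm.
have mh := cL1_measurable cL1_optimal_char.
have [Lf Lg] := (spectral_L1 sf, spectral_L1 sg).
have [_ _ Lp _] := bounded_err mp pK Lf Lg.
have [_ _ Lh _] := bounded_err mh hK Lf Lg.
pose d x := p x - h0 x.
have md : cmeasurable d by exact: cmeasurableB.
have dK : aecirc (fun x => cmodulus (d x) <= K' + K).
  apply: (aecirc_imp2 hK pK) => x _ hx px; apply: (le_trans (cmodulusD _ _)).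
  by rewrite lerD// cmodulusN.
have Ld := L1_sqnorm md dK (L1D Lf Lg).
have cLd := cL1_bounded md dK.
split=> //.
have d0 : no_low_freq N d.
  apply: no_low_freqB => //; [exact: cL1_bounded pK|exact: cL1_optimal_char|].
  exact: no_low_freq_optimal_char.
have [M hM] := trigpoly_bounded (interp_coef a f g).
have LdC : cL1 (fun x => d x * (C x)^*%R).
  rewrite (_ : (fun x => _) = (fun x => (C x)^*%R * d x)); last first.
    by apply/funext => x; rewrite mulrC.
  apply: (@cL1_mul _ M) => //.
    by apply: cmeasurable_conj; exact: cmeasurable_trigpoly.
  apply: aecircW => x _; move: (hM x); rewrite -/(interp_poly a f g x) -/(C x).
  by congr (_ <= _); rewrite /cmodulus; case: (C x) => b c /=; rewrite sqrrN.
have [LReC _] := LdC.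
have IC : Icirc (fun x => Re (d x * (C x)^*%R)) = 0.
  have := no_low_freq_orthogonal (interp_coef a f g) cLd d0.
  by move=> /(congr1 (@complex.Re R)).
(* A vanishing integral is subtracted so that both sides become integrals of functions equal almost
   everywhere. *)
rewrite -[RHS]subr0 -(mulr0 2) -IC -IcircD// -IcircZ// -IcircB; last 2 first.
- exact: L1D.
- exact: L1Z.
apply: eq_Icirc_ae.
- exact: L1_measurable.
- by apply: L1_measurable; apply: L1B; [exact: L1D|exact: L1Z].
apply: (aecirc_imp aew) => x _ wx.
have CE : C x = A x * (f x)%:C - h0 x * (w x)%:C.
  rewrite /h0 /optimal_char divfK; first by rewrite subKr.
  by rewrite eq_complex /= eqxx andbT gt_eqF.
rewrite CE /err /d /w; move: (A x) (h0 x) (p x) => [a1 a2] [h1 h2] [p1 p2].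
by rewrite !sqr_cmodulus /=; ring.
Qed.

(** The Pythagorean identity is stated for bounded functions, so [h] is first replaced by a nearby
    finite sum [p] of observed exponentials, at a cost controlled by [sqr_cmodulusD_le]. *)
Lemma optimal_char_le K h : aecirc (fun x => cmodulus (h0 x) <= K) ->
  L2N N (f \+ g) h -> (Delta a h0 f g <= Delta a h f g)%E.
Proof.
move=> hK [mh hfin happ]; have [Lf Lg] := (spectral_L1 sf, spectral_L1 sg).
have [[f0 _] [g0 _]] := (sf, sg).
have mh0 := cL1_measurable cL1_optimal_char.
have [w0 Lw] := spectral_densityD sf sg; have {}Lw : L1 (f \+ g) by exact: Lw.
have msq : mfun (fun x => cmodulus (h x) ^+ 2) by exact: measurable_sqr_cmodulus.
have Lhw := sqnorm_lty_L1 mh Lw w0 hfin.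
have Lhf : L1 (fun x => cmodulus (h x) ^+ 2 * f x).
  apply: (L1_dom _ Lhw); first by apply: measurable_funM => //; exact: L1_measurable.
  apply: aecircW => x cx; rewrite ger0_norm ?sqrM_ge0 ?f0//.
  by rewrite ler_wpM2l ?sqr_ge0//= lerDl g0.
have Lhg : L1 (fun x => cmodulus (h x) ^+ 2 * g x).
  apply: (L1_dom _ Lhw); first by apply: measurable_funM => //; exact: L1_measurable.
  apply: aecircW => x cx; rewrite ger0_norm ?sqrM_ge0 ?g0//.
  by rewrite ler_wpM2l ?sqr_ge0//= lerDr f0.
have LAh : L1 (fun x => cmodulus (A x - h x) ^+ 2 * f x).
  have LA := L1_sqr_trigpolyM a Lf.
  apply: (L1_dom _ (L1D (L1Z 2 LA) (L1Z 2 Lhf))).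
    apply: measurable_funM; last exact: L1_measurable.
    apply: measurable_sqr_cmodulus; apply: cmeasurableB => //.
    exact: cmeasurable_trigpoly.
  apply: aecircW => x cx; rewrite ger0_norm ?sqrM_ge0 ?f0//.
  rewrite !(mulrA 2 (_ ^+ 2)) -mulrDl ler_wpM2r ?f0//.
  have := @sqr_cmodulusD_le 1 (A x) (- h x) ltr01.
  by rewrite cmodulusN invr1.
have Lerr : L1 (err h f g) by exact: L1D.
have -> : Delta a h f g = ((2 * pi)^-1 * Icirc (err h f g))%:E.
  by rewrite /Delta !sqnormE// -!EFinM -EFinD -mulrDr -IcircD.
have [_ _ Lerr0 ->] := bounded_err mh0 hK Lf Lg.
rewrite lee_fin ler_pM2l ?inv2pi_gt0//.
have E0 : 0 <= Icirc (err h f g).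
  apply: Icirc_ge0 => x cx.
  by rewrite addr_ge0// sqrM_ge0 ?f0 ?g0.
apply/ler_addgt0Pr => e e0.
(* With [p] within [t ^+ 2] of [h] in squared norm, the error integral of [p] exceeds that of [h],
   say [E], by at most [t E + (1 + t^-1) t^2 = t (E + 1 + t)], which is at most [t (E + 2) <= e]. *)
have [t [t0 t1 tE]] : exists t : R, [/\ 0 < t, t <= 1 & t * (Icirc (err h f g) + 2) <= e].
  have E2 : 0 < Icirc (err h f g) + 2 by rewrite ltr_wpDl.
  exists (Num.min 1 (e / (Icirc (err h f g) + 2))); split.
  - by rewrite lt_min ltr01 divr_gt0.
  - by rewrite ge_min lexx.
  - by rewrite -ler_pdivlMr// ge_min lexx orbT.
have [p [sp hp]] := happ (t ^+ 2) (exprn_gt0 _ t0).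
have [mp [K' hp'] p0] := observed_spanP sp.
have mhp : cmeasurable (fun x => h x - p x) by exact: cmeasurableB.
have LS := sqnorm_lty_L1 mhp Lw w0 (lt_trans hp (ltry _)).
move: hp; rewrite sqnormE// lte_fin => hp.
have [_ Ep] := optimal_char_pythagoras hK mp (aecircW (fun x _ => hp' x)) p0.
have [_ _ Lerrp _] := bounded_err mp (aecircW (fun x _ => hp' x)) Lf Lg.
pose S x := cmodulus (h x - p x) ^+ 2 * (f \+ g) x.
rewrite -/S in LS hp.
have Ip : Icirc (err h0 f g) <= Icirc (err p f g).
  rewrite Ep lerDl; apply: Icirc_ge0 => x cx; rewrite sqrM_ge0//.
  exact: w0.
have Ile : Icirc (err p f g) <= Icirc (fun x => (1 + t) * err h f g x + (1 + t^-1) * S x).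
  apply: le_Icirc => //; first exact: (L1D (L1Z _ Lerr) (L1Z _ LS)).
  move=> x cx.
  have h1 := sqr_cmodulusD_le (A x - h x) (h x - p x) t0.
  have h2 := sqr_cmodulusD_le (h x) (- (h x - p x)) t0.
  rewrite addrA subrK in h1; rewrite opprB addrC subrK -opprB cmodulusN in h2.
  have fx := f0 x cx; have gx := g0 x cx.
  have k1 := ler_wpM2r fx h1; have k2 := ler_wpM2r gx h2.
  apply: (le_trans (lerD k1 k2)); rewrite le_eqVlt; apply/orP; left; apply/eqP.
  by rewrite /err /S /=; ring.
rewrite (IcircD (L1Z _ Lerr) (L1Z _ LS)) (IcircZ _ Lerr) (IcircZ _ LS) in Ile.
have tS : (1 + t^-1) * Icirc S <= 2 * t.
  apply: (@le_trans _ _ ((1 + t^-1) * t ^+ 2)).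
    by rewrite ler_wpM2l ?(ltW hp)// addr_ge0// invr_ge0 ltW.
  have -> : (1 + t^-1) * t ^+ 2 = t ^+ 2 + t by field; rewrite gt_eqF.
  by have : t ^+ 2 <= t by [rewrite expr2 ler_piMr// ltW]; lra.
lra.
Qed.

(** Where [w > 0], one has [w h0 = A f - C] and [w (A - h0) = A g + C], so in
    [|A - h0|^2 f + |h0|^2 g] the cross terms cancel and [|C|^2 / w + |A|^2 f g / w] remains.
    Maximality of the functional thus compares errors. *)
Lemma interp_functionalE :
  interp_functional a f g = ((2 * pi)^-1 * Icirc (err h0 f g))%:C.
Proof.
have [aew LV] := minimalityP sf sg hm; have LQ := L1_harmonic sf sg.
have mh := cL1_measurable cL1_optimal_char.
have mA := cmeasurable_trigpoly a.
have LCV := L1_sqr_trigpolyM (interp_coef a f g) LV.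
have LAQ := L1_sqr_trigpolyM a LQ.
(* [R a = B (B^-1 R a)] makes the first pairing a quadratic form of [B]. *)
have -> : interp_functional a f g = cdot (matB N f g *m interp_coef a f g) (interp_coef a f g) +
    cdot (matQ N f g *m a) a.
  by rewrite /interp_functional {3}/interp_coef mulKVmx// matB_unit.
rewrite !cdot_toeplitz// -rmorphD /= -mulrDr -IcircD//; congr ((_ * _)%:C).
have Lf := spectral_L1 sf; have Lg := spectral_L1 sg.
apply: eq_Icirc_ae; first by apply: L1_measurable; exact: L1D.
  apply: measurable_funD; apply: measurable_funM; try exact: L1_measurable.
  - by apply: measurable_sqr_cmodulus; exact: cmeasurableB.
  - exact: measurable_sqr_cmodulus.
apply: (aecirc_imp aew) => x _ wx.
rewrite -/(interp_poly a f g x) -/(C x) -/(A x) /err.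
have wn : f x + g x != 0 by rewrite gt_eqF.
have HR : Re (h0 x) = (Re (A x) * f x - Re (C x)) / (f x + g x).
  rewrite /h0 optimal_charE -/(A x) -/(C x) ReB !ReM /= !mulr0 !subr0.
  by field.
have HI : Im (h0 x) = (Im (A x) * f x - Im (C x)) / (f x + g x).
  rewrite /h0 optimal_charE -/(A x) -/(C x) ImB !ImM /= !mulr0 !add0r.
  by field.
rewrite !sqr_cmodulus ReB ImB HR HI; field.
by [].
Qed.

End Optimal.
End OptimalEstimate.


(** * The extremal density and the saddle point inequality *)

Section LeastFavourable.
Context {R : realType}.

#[local] Opaque Icirc.

Lemma L1_ballP (g1 g : R -> R) (eps : R) : spectral_density g1 ->
  L1_ball g1 eps g <-> spectral_density g /\
    (2 * pi)^-1 * Icirc (fun x => `|g x - g1 x|) <= eps.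
Proof.
move=> s1; split=> -[sg h]; split => //; have L := L1_norm (L1B (spectral_L1 sg) (spectral_L1 s1)).
  by rewrite -lee_fin EFinM EFin_Icirc.
by rewrite -EFin_Icirc// -EFinM lee_fin.
Qed.

Lemma spectral_densityDc (g : R -> R) (s : R) : 0 <= s -> spectral_density g ->
  spectral_density (fun x => g x + s).
Proof.
move=> s0 sg; have [g0 _] := sg; split; first by move=> x cx; rewrite addr_ge0 ?g0.
apply: (L1D (spectral_L1 sg)); exact: L1_cst.
Qed.

Lemma minimality_lower_bound (f g : R -> R) (s : R) : 0 < s -> spectral_density f ->
  spectral_density g -> (forall x, circle x -> s <= f x + g x) -> minimality f g.
Proof.
move=> s0 sf sg hs.
have LV : L1 (fun x => (f x + g x)^-1).
  apply: (@L1_bounded _ s^-1).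
    have [w0 Lw] := spectral_densityD sf sg.
    by apply: measurable_inv => //; exact: L1_measurable.
  apply: aecircW => x cx; have w0 := lt_le_trans s0 (hs x cx).
  by rewrite ger0_norm ?invr_ge0 ?(ltW w0)// lef_pV2// hs.
suff -> : minimality f g = ((Icirc (fun x => (f x + g x)^-1))%:E < +oo)%E by exact: ltry.
rewrite EFin_Icirc//; congr (is_true (_ < _)%E); apply: eq_integral => x /set_mem cx.
by rewrite inver gt_eqF// (lt_le_trans s0)// hs.
Qed.

(** In [A f / w - C / w] the first term is at most [|A|] in modulus and the second at most
    [|C| / s]. *)
Lemma optimal_char_bounded N (a : 'cV[R[i]]_N.+1) (f g : R -> R) (s : R) : 0 < s ->
  spectral_density f -> spectral_density g -> (forall x, circle x -> s <= f x + g x) ->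
  exists K, forall x, circle x -> cmodulus (optimal_char a f g x) <= K.
Proof.
move=> s0 sf sg hs.
have [M hM] := trigpoly_bounded a; have [M' hM'] := trigpoly_bounded (interp_coef a f g).
exists (M + M' * s^-1) => x cx; have w0 := lt_le_trans s0 (hs x cx).
rewrite optimal_charE; apply: (le_trans (cmodulusD _ _)).
rewrite cmodulusN !cmodulusM !cmodulusR; apply: lerD.
  have /andP[q0 q1] := spectral_quotient_le1 sf sg cx.
  rewrite -[leRHS]mulr1 ler_pM ?cmodulus_ge0// ?hM//.
  by rewrite ger0_norm.
rewrite div1r ger0_norm ?invr_ge0 ?(ltW w0)//.
by rewrite ler_pM ?cmodulus_ge0// ?invr_ge0 ?(ltW w0)// ?hM'// lef_pV2// hs.
Qed.

Section Extremal.
Variables (N : nat) (a : 'cV[R[i]]_N.+1) (eps2 alpha2 : R) (g1 f g0 : R -> R).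
Hypotheses (hg1 : spectral_density g1) (hf : spectral_density f).
Hypotheses (hg0 : L1_ball g1 eps2 g0) (hmin : minimality f g0) (halpha2 : 0 < alpha2).
Hypothesis hg0eq : aecirc (fun x => g0 x = Num.max (g1 x)
  (alpha2^-1 * cmodulus (trigpoly a x * (f x)%:C - interp_poly a f g0 x) - f x)).
Hypothesis hopt : forall g, L1_ball g1 eps2 g -> minimality f g ->
  interp_functional a f g <= interp_functional a f g0.

Let h0 := optimal_char a f g0.

Let sg0 : spectral_density g0. Proof. by case: hg0. Qed.

(** The second entry of the maximum gives [f + g0 >= |A f - C| / alpha2], with equality where
    [g0 > g1], since that entry then attains the maximum. It remains to divide by [f + g0], positive
    almost everywhere. *)
Lemma optimal_char_extremal : aecirc (fun x => [/\ cmodulus (h0 x) <= alpha2,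
  g1 x <= g0 x & g1 x < g0 x -> cmodulus (h0 x) = alpha2]).
Proof.
have [aew _] := minimalityP hf sg0 hmin.
apply: (aecirc_imp2 hg0eq aew) => x _ g0E w0.
set z := trigpoly a x * (f x)%:C - interp_poly a f g0 x in g0E.
have -> : cmodulus (h0 x) = cmodulus z / (f x + g0 x).
  by rewrite /h0 /optimal_char -/z cmodulusM cmodulusV cmodulusR gtr0_norm.
split.
- rewrite ler_pdivrMr// -ler_pdivrMl// -lerBlDl; rewrite [leRHS]g0E le_max; apply/orP; right.
  by [].
- by rewrite g0E le_max lexx.
- move=> lt10; have : g0 x = alpha2^-1 * cmodulus z - f x.
    have [le1|/ltW le1] := leP (g1 x) (alpha2^-1 * cmodulus z - f x).
      by rewrite g0E max_r.
    by move: lt10; rewrite g0E max_l// ltxx.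
  move=> g0z; have zE : f x + g0 x = alpha2^-1 * cmodulus z by rewrite g0z addrC subrK.
  rewrite zE in w0 *.
  have z0 : cmodulus z != 0 by apply: contraTneq w0 => ->; rewrite mulr0 ltxx.
  by field; rewrite z0 gt_eqF.
Qed.

(** For the fixed estimate [h0], this is the only term of [Delta] that depends on the noise
    density. *)
Lemma energy_le g : L1_ball g1 eps2 g ->
  Icirc (fun x => cmodulus (h0 x) ^+ 2 * g x) <= Icirc (fun x => cmodulus (h0 x) ^+ 2 * g0 x).
Proof.
move=> /(L1_ballP _ _ hg1)[sg hg]; have [_ he] := (L1_ballP _ _ hg1).1 hg0.
have ext := optimal_char_extremal.
have hK : aecirc (fun x => cmodulus (h0 x) <= alpha2).
  by apply: (aecirc_imp ext) => x _ [].
have cLh0 := cL1_optimal_char a hf sg0 hmin; have mh0 := cL1_measurable cLh0.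
have [Lf Lg0] := (spectral_L1 hf, spectral_L1 sg0).
have [Lg1 Lg] := (spectral_L1 hg1, spectral_L1 sg).
have LWg := L1_sqnorm mh0 hK Lg; have LWg0 := L1_sqnorm mh0 hK Lg0.
have Lgg1 := L1_norm (L1B Lg Lg1); have Lg01 := L1_norm (L1B Lg0 Lg1).
have [tight|slack] := leP eps2 ((2 * pi)^-1 * Icirc (fun x => `|g0 x - g1 x|)).
  rewrite -subr_le0 -IcircB//.
  (* Pointwise, [|h0|^2 (g - g0) <= alpha2^2 (|g - g1| - |g0 - g1|)]: by [|h0| <= alpha2] where
     [g0 = g1], by [|h0| = alpha2] where [g0 > g1]. The right side has nonpositive integral, since
     [g0] is as far from [g1] as the ball allows. *)
  apply: (@le_trans _ _ (Icirc (fun x => alpha2 ^+ 2 * `|g x - g1 x| -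
      alpha2 ^+ 2 * `|g0 x - g1 x|))).
    apply: le_Icirc_ae; [exact: L1B|by apply: L1B; exact: L1Z|].
    apply: (aecirc_imp ext) => x _ [hx le10 lt10].
    have W0 : 0 <= cmodulus (h0 x) ^+ 2 by exact: sqr_ge0.
    have W1 : cmodulus (h0 x) ^+ 2 <= alpha2 ^+ 2.
      by rewrite lerXn2r ?nnegrE ?cmodulus_ge0// (ltW halpha2).
    rewrite (ger0_norm (x := g0 x - g1 x)) ?subr_ge0//.
    move: le10; rewrite le_eqVlt => /orP[/eqP <-|/lt10 ->].
      rewrite subrr mulr0 subr0 -mulrBr.
      apply: (le_trans (ler_wpM2l W0 (ler_norm _))).
      by rewrite ler_wpM2r.
    have -> : alpha2 ^+ 2 * g x - alpha2 ^+ 2 * g0 x =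
      alpha2 ^+ 2 * (g x - g1 x) - alpha2 ^+ 2 * (g0 x - g1 x) by ring.
    by rewrite lerD2r ler_wpM2l ?sqr_ge0// ler_norm.
  rewrite IcircB; [|exact: L1Z..]; rewrite !IcircZ// -mulrBr mulr_ge0_le0 ?sqr_ge0//.
  by rewrite subr_le0 -(ler_pM2l inv2pi_gt0); exact: le_trans hg tight.
suff h00 : aecirc (fun x => cmodulus (h0 x) ^+ 2 = 0).
  rewrite le_eqVlt; apply/orP; left; apply/eqP; apply: eq_Icirc_ae; try exact: L1_measurable.
  by apply: (aecirc_imp h00) => x _ ->; rewrite !mul0r.
(* The radius left over. Raising [g0] by this constant adds at most [s] to the normalized distance,
   and [f + gs >= s] then gives [minimality] and a bounded [hs]. *)
pose s := eps2 - (2 * pi)^-1 * Icirc (fun x => `|g0 x - g1 x|).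
have s0 : 0 < s by rewrite subr_gt0.
pose gs x := g0 x + s.
have sgs : spectral_density gs by apply: spectral_densityDc => //; exact: ltW.
have gsball : L1_ball g1 eps2 gs.
  apply/(L1_ballP _ _ hg1); split => //.
  have -> : eps2 = (2 * pi)^-1 * (Icirc (fun x => `|g0 x - g1 x|) + s * (2 * pi)).
    rewrite mulrDr mulrCA mulVf ?mulr1; first by rewrite /s; ring.
    by rewrite gt_eqF// -invr_gt0 inv2pi_gt0.
  rewrite ler_pM2l ?inv2pi_gt0// -Icirc_cst -IcircD//; last exact: L1_cst.
  apply: le_Icirc.
  - exact/L1_norm/L1B/Lg1/spectral_L1.
  - by apply: L1D => //; exact: L1_cst.
  - move=> x _; rewrite /gs addrAC; apply: (le_trans (ler_normD _ _)).
    by rewrite lerD2l gtr0_norm.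
have ws x : circle x -> s <= f x + gs x.
  by move=> cx; rewrite /gs addrA lerDr addr_ge0//; [apply: hf.1|apply: sg0.1].
have mgs : minimality f gs by exact: minimality_lower_bound ws.
pose hs := optimal_char a f gs.
have [K hsK] := optimal_char_bounded a s0 hf sgs ws.
have mhs := cL1_measurable (cL1_optimal_char a hf sgs mgs).
have hsKae := aecircW hsK.
have := hopt gsball mgs; rewrite !interp_functionalE// lecR ler_pM2l ?inv2pi_gt0// => le_err.
have [Lpy py] := optimal_char_pythagoras hf sg0 hmin hK mhs hsKae
  (no_low_freq_optimal_char a hf sgs mgs).
have [_ _ Lerr _] := bounded_err a mhs hsKae Lf Lg0.
have Lhs2 : L1 (fun x => cmodulus (hs x) ^+ 2).
  have := L1_sqnorm mhs hsKae (L1_cst 1).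
  rewrite (_ : (fun x => _) = (fun x => cmodulus (hs x) ^+ 2))//.
  by apply/funext => x; rewrite mulr1.
(* Together with the Pythagorean identity for [hs] under [g0], this reduces maximality to a sum of
   two nonnegative terms, the integral of [|hs - h0|^2 (f + g0)] and [s] times that of [|hs|^2],
   being at most 0. *)
have errE : Icirc (err a hs f gs) =
    Icirc (err a hs f g0) + s * Icirc (fun x => cmodulus (hs x) ^+ 2).
  rewrite -IcircZ// -IcircD//; last exact: L1Z.
  by apply: eq_Icirc => x _; rewrite /err /gs; ring.
rewrite -/hs errE py -addrA gerDl in le_err.
have I1 : 0 <= Icirc (fun x => cmodulus (hs x) ^+ 2) by apply: Icirc_ge0 => x _; exact: sqr_ge0.
have pos x : circle x -> 0 <= cmodulus (hs x - h0 x) ^+ 2 * (f x + g0 x).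
  by move=> cx; rewrite sqrM_ge0// addr_ge0//; [apply: hf.1|apply: sg0.1].
have I2 := Icirc_ge0 pos.
have sI : 0 <= s * Icirc (fun x => cmodulus (hs x) ^+ 2) by rewrite mulr_ge0// ltW.
have z1 : aecirc (fun x => cmodulus (hs x) ^+ 2 = 0).
  apply: Icirc_eq0 => //; first by apply: aecircW => x _; exact: sqr_ge0.
  rewrite -(ler_pM2l s0) mulr0; apply: le_trans le_err; by rewrite lerDr.
have z2 : aecirc (fun x => cmodulus (hs x - h0 x) ^+ 2 * (f x + g0 x) = 0).
  apply: Icirc_eq0 => //; first exact: aecircW.
  by apply: le_trans le_err; rewrite lerDl.
have [aew _] := minimalityP hf sg0 hmin.
have z3 : aecirc (fun x => cmodulus (hs x - h0 x) ^+ 2 = 0).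
  apply: (aecirc_imp2 z2 aew) => x _ /eqP + w0.
  by rewrite mulf_eq0 (gt_eqF w0) orbF => /eqP.
apply: (aecirc_imp2 z1 z3) => x _ /eqP; rewrite expf_eq0 /= => /eqP hs0.
move=> /eqP; rewrite expf_eq0 /= => /eqP /(@ComplexField.Normc.eq0_normc R).
move: hs0 => /(@ComplexField.Normc.eq0_normc R) ->.
by move=> /eqP; rewrite sub0r oppr_eq0 => /eqP ->; rewrite cmodulusR normr0 expr0n.
Qed.

Lemma Delta_optimal_char_le g : L1_ball g1 eps2 g ->
  (Delta a h0 f g <= Delta a h0 f g0)%E.
Proof.
move=> hg; have sg := hg.1; have le_g := energy_le hg.
have hK : aecirc (fun x => cmodulus (h0 x) <= alpha2).
  by apply: (aecirc_imp optimal_char_extremal) => x _ [].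
have mh0 := cL1_measurable (cL1_optimal_char a hf sg0 hmin).
have [Lf Lg0 Lg] := And3 (spectral_L1 hf) (spectral_L1 sg0) (spectral_L1 sg).
have [L1f L1g _ ->] := bounded_err a mh0 hK Lf Lg.
have [_ L1g0 _ ->] := bounded_err a mh0 hK Lf Lg0.
rewrite lee_fin ler_pM2l ?inv2pi_gt0// /err IcircD// [leRHS]IcircD//.
by rewrite lerD2l.
Qed.

(** Neither the bound [alpha2] nor the vanishing coefficients of [h0] involve [g], so [bounded_L2N]
    applies for every [g] of the ball. *)
Lemma optimal_char_L2N g : L1_ball g1 eps2 g -> L2N N (f \+ g) h0.
Proof.
move=> hg; have hK : aecirc (fun x => cmodulus (h0 x) <= alpha2).
  by apply: (aecirc_imp optimal_char_extremal) => x _ [].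
apply: bounded_L2N hK _ _.
- exact: cL1_measurable (cL1_optimal_char a hf sg0 hmin).
- exact: no_low_freq_optimal_char.
- by apply: spectral_densityD => //; exact: hg.1.
Qed.

Lemma optimal_char_min h : L2N N (f \+ g0) h -> (Delta a h0 f g0 <= Delta a h f g0)%E.
Proof.
have hK : aecirc (fun x => cmodulus (h0 x) <= alpha2).
  by apply: (aecirc_imp optimal_char_extremal) => x _ [].
exact: optimal_char_le hK.
Qed.

End Extremal.
End LeastFavourable.


(** * From the saddle point to least favourability and minimax robustness *)

Theorem theorem7p9 (R : realType) (N : nat) (a : 'cV[R[i]]_N.+1) (eps2 : R)
    (g1 f g0 : R -> R) (alpha2 : R)
    (heps2 : 0 < eps2)
    (hg1 : spectral_density g1) (hg1b : ess_bounded g1)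
    (hf : spectral_density f)
    (hg0 : L1_ball g1 eps2 g0)
    (hmin : minimality f g0)
    (hgb : ess_bounded (fun x =>
       cmodulus (trigpoly a x * (f x)%:C - interp_poly a f g0 x) ^+ 2 / (f x + g0 x) ^+ 2))
    (halpha2 : 0 < alpha2)
    (hg0eq : {ae @lebesgue_measure R, forall x, circle x ->
       g0 x = Num.max (g1 x)
         (alpha2^-1 * cmodulus (trigpoly a x * (f x)%:C - interp_poly a f g0 x) - f x)})
    (hopt : forall g, L1_ball g1 eps2 g -> minimality f g ->
       interp_functional a f g <= interp_functional a f g0) :
  least_favourable a f (L1_ball g1 eps2) g0 /\
  minimax_robust a f (L1_ball g1 eps2)
    (fun x => (trigpoly a x * (f x)%:C - interp_poly a f g0 x) / (f x + g0 x)%:C).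
Proof.
pose h0 := optimal_char a f g0.
have hmem g : L1_ball g1 eps2 g -> L2N N (f \+ g) h0.
  by move=> hg; exact: (optimal_char_L2N hf hg0 hmin halpha2 hg0eq hg).
have hle g : L1_ball g1 eps2 g -> (Delta a h0 f g <= Delta a h0 f g0)%E.
  by move=> hg; exact: (Delta_optimal_char_le hg1 hf hg0 hmin halpha2 hg0eq hopt hg).
have h0_min h : L2N N (f \+ g0) h -> (Delta a h0 f g0 <= Delta a h f g0)%E.
  exact: (optimal_char_min hf hg0 hmin halpha2 hg0eq).
split; split.
- exact: hg0.
- exists h0; first by split; [exact: hmem|exact: h0_min].
  (* [h0] competes in the minimization for [g], so the minimal error at [g] is at most the error of
     [h0] at [g], hence at most that at [g0]. *)
  by move=> g h hg [_ hmin_g]; apply: le_trans (hle g hg); apply: hmin_g; exact: hmem.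
- by move=> g hg; exact: hmem.
(* For each [g], [Delta a h0 f g <= Delta a h0 f g0 <= Delta a h f g0], and the last value is among
   those whose supremum is the worst error of [h]. *)
move=> h hh; apply: ge_ereal_sup => _ [g hg <-].
apply: (le_trans (hle g hg)); apply: (le_trans (h0_min h (hh g0 hg0))).
by apply: ereal_sup_ubound; exists g0.
Qed.
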